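(* Let $\beta\in(0,2)$, $\gamma\ge 0$, $\sigma\in(\beta,2]$, $\Omega=(-l,l)\times(-l,l)$ with $l>0$, and let $(\Delta+\gamma)^{\beta/2}_h$ be the finite difference approximation (with mesh size $h=l/N$, $N\in\mathbb{N}^+$) of the tempered fractional Laplacian $(\Delta+\gamma)^{\beta/2}$ described in the context. Suppose that $G\in C^2(\bar\Omega)$ and that $G(x,y)=0$ for all $(x,y)\in\mathbb{R}^2\setminus\Omega$. Then there is a constant $C>0$, depending on $\beta$ and $\gamma$ (and on $G$, but not on $h$), such that $$\left\|\mathcal{V}\big[(\Delta+\gamma)^{\beta/2}G\big]-(\Delta+\gamma)^{\beta/2}_h\,\mathcal{V}G\right\|_{l^\infty}\le C h^{2-\beta}$$ and $$\left\|\mathcal{V}\big[(\Delta+\gamma)^{\beta/2}G\big]-(\Delta+\gamma)^{\beta/2}_h\,\mathcal{V}G\right\|_{l^2}\le C h^{2-\beta}.$$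
   Context: Tempered fractional Laplacian: for $\beta\in(0,2)$, $\gamma\ge 0$ and $G:\mathbb{R}^2\to\mathbb{C}$, $$(\Delta+\gamma)^{\beta/2}G(\mathbf{x})=-c_{2,\beta}\,\mathrm{P.V.}\int_{\mathbb{R}^2}\frac{G(\mathbf{x})-G(\mathbf{y})}{e^{\gamma|\mathbf{x}-\mathbf{y}|}|\mathbf{x}-\mathbf{y}|^{2+\beta}}\,d\mathbf{y},$$ where $c_{2,\beta}=\frac{1}{2\pi|\Gamma(-\beta)|}$ if $\gamma>0$ and $\beta\ne1$, and $c_{2,\beta}=\frac{\beta\Gamma((2+\beta)/2)}{2^{1-\beta}\pi\Gamma(1-\beta/2)}$ if $\gamma=0$ or $\beta=1$. Grid: $h=l/N$, $x_i=ih$, $y_j=jh$ for $-N\le i,j\le N$. For a function $f$ on $\Omega$, $\mathcal{V}f\in\mathbb{C}^{(2N-1)^2}$ is the vector of values $f(x_p,y_q)$, $-N<p,q<N$ (lexicographically ordered). Discrete norms: $\|\mathbf{v}\|_{l^2}=\big(h^2\sum_i|v_i|^2\big)^{1/2}$, $\|\mathbf{v}\|_{l^\infty}=\max_i|v_i|$. Discrete operator: for a grid vector $v=(v_{p,q})_{-N<p,q<N}$, extended by $v_{i,j}=0$ when $|i|=N$ or $|j|=N$, and for $-N<p,q<N$, $$\big((\Delta+\gamma)^{\beta/2}_h v\big)_{p,q}=c_{2,\beta}\Big[\tfrac{k_\sigma}{4}W_{0,0}\,(\phi_{0,1}+\phi_{1,0}+\phi_{1,1})+\sum_{\substack{-N\le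 i,j\le N-1\\(i,j)\notin\mathcal{I}_{p,q}}}I_{p,q,i,j}-W^\infty_{p,q}v_{p,q}\Big].$$ Here $k_\sigma=1$ if $\sigma\in(\beta,2)$ and $k_\sigma=4/3$ if $\sigma=2$; $W_{0,0}=\int_0^h\int_0^h(\xi^2+\eta^2)^{(\sigma-2-\beta)/2}d\eta\,d\xi$; $$\phi_{a,b}=\frac{v_{p+a,q+b}+v_{p-a,q+b}+v_{p-a,q-b}+v_{p+a,q-b}-4v_{p,q}}{e^{\gamma h\sqrt{a^2+b^2}}\,(h\sqrt{a^2+b^2})^{\sigma}};$$ $\mathcal{I}_{p,q}=\{(p,q),(p-1,q),(p,q-1),(p-1,q-1)\}$; $$I_{p,q,i,j}=\int_{ih}^{(i+1)h}\int_{jh}^{(j+1)h}B_{i,j}(\xi,\eta)\,\big((\xi-x_p)^2+(\eta-y_q)^2\big)^{-(2+\beta)/2}d\eta\,d\xi,$$ where $B_{i,j}$ is the bilinear interpolant on the cell $[ih,(i+1)h]\times[jh,(j+1)h]$ of the four corner values $(v_{i',j'}-v_{p,q})e^{-\gamma h\sqrt{(i'-p)^2+(j'-q)^2}}$, $i'\in\{i,i+1\}$, $j'\in\{j,j+1\}$; and $$W^\infty_{p,q}=\int\int_{\mathbb{R}^2\setminus\Omega}e^{-\gamma\sqrt{(\xi-x_p)^2+(\eta-y_q)^2}}\big((\xi-x_p)^2+(\eta-y_q)^2\big)^{-(2+\beta)/2}d\xi\,d\eta.$$ *)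

(* Defs.v *)
From HB Require Import structures.
From mathcomp Require Import all_boot all_order all_algebra.
From mathcomp Require Import complex.
From mathcomp Require Import all_classical all_reals all_analysis.

Set Implicit Arguments.
Unset Strict Implicit.
Unset Printing Implicit Defensive.

Import Order.TTheory GRing.Theory Num.Theory.
Import numFieldNormedType.Exports.

Local Open Scope classical_set_scope.
Local Open Scope ring_scope.
Local Open Scope complex_scope.

Section Gamma.
Variable R : realType.
Implicit Types s x : R.

(* The Euler integral, which converges for 0 < s only. *)
Definition euler_gamma s : R :=
  \int[lebesgue_measure]_(t in `]0, +oo[%classic) (t `^ (s - 1) * expR (- t)).

(* Extended to the negative non-integers by
   Gamma(x) = Gamma(x + n) / (x (x + 1) ... (x + n - 1)), where n is the least
   number with 0 < x + n.  At the poles 0, -1, -2, ... the value is junk. *)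
Definition Gamma x : R :=
  let n := if 0 < x then 0%N else (Num.truncn (- x)).+1 in
  euler_gamma (x + n%:R) / \prod_(k < n) (x + k%:R).

End Gamma.

Section Plane.
Variable R : realType.
Implicit Types (x y z : R * R) (D U : set (R * R)).

Definition eucl_dist x y : R :=
  Num.sqrt ((x.1 - y.1) ^+ 2 + (x.2 - y.2) ^+ 2).

Definition int2 D (f : R * R -> R) : R :=
  Rintegral (@lebesgue_measure R \x @lebesgue_measure R)%E D f.

Definition cint2 D (f : R * R -> R[i]) : R[i] :=
  int2 D (fun y => complex.Re (f y)) +i* int2 D (fun y => complex.Im (f y)).

(* Principal value at x of the integral of f over the plane; the limit is
   taken separately in the real and imaginary parts. *)
Definition pv_int2 x (f : R * R -> R[i]) : R[i] :=
  let I e := cint2 [set y | e < eucl_dist x y] f in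
  lim (complex.Re (I e) @[e --> (0 : R)^'+]) +i*
  lim (complex.Im (I e) @[e --> (0 : R)^'+]).

Definition square (l : R) : set (R * R) :=
  [set z | (- l < z.1 < l) && (- l < z.2 < l)].

Definition axis (b : bool) : R * R := if b then (0, 1) else (1, 0).

Definition extends_continuously U (f : R * R -> R) : Prop :=
  exists F : R * R -> R,
    {within closure U, continuous F} /\ (forall z, U z -> F z = f z).

(* C^2 up to the boundary of the open set U: the partial derivatives of order
   at most 2 exist in U and extend continuously to the closure of U. *)
Definition C2_closure_real U (g : R * R -> R) : Prop :=
  [/\ {within closure U, continuous g},
      forall b : bool,
        (forall z, U z -> derivable g z (axis b)) /\
        extends_continuously U ('D_(axis b) g)
    & forall b c : bool,
        (forall z, U z -> derivable ('D_(axis b) g) z (axis c)) /\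
        extends_continuously U ('D_(axis c) ('D_(axis b) g))].

Definition C2_closure U (G : R * R -> R[i]) : Prop :=
  C2_closure_real U (fun z => complex.Re (G z)) /\
  C2_closure_real U (fun z => complex.Im (G z)).

End Plane.

Section TemperedFractionalLaplacian.
Variables (R : realType) (beta gamma : R).

Definition c2 : R :=
  if (0 < gamma) && (beta != 1)
  then 1 / (2 * pi * `|Gamma (- beta)|)
  else beta * Gamma ((2 + beta) / 2) /
       (2 `^ (1 - beta) * pi * Gamma (1 - beta / 2)).

Definition tempered_laplacian (G : R * R -> R[i]) (x : R * R) : R[i] :=
  - (c2%:C * pv_int2 x (fun y =>
      (G x - G y) /
      (expR (gamma * eucl_dist x y) * eucl_dist x y `^ (2 + beta))%:C)).

End TemperedFractionalLaplacian.

Section Grid.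
Variables (R : realType) (l : R) (N : nat).

Definition mesh : R := l / N%:R.

Definition point (i j : int) : R * R := (i%:~R * mesh, j%:~R * mesh).

(* The interior indices -N < p < N, as 0 <= a < 2N - 1 with p = a - N + 1. *)
Definition nint : nat := N.*2.-1.

Definition node (a : 'I_nint) : int := (a : nat)%:Z - N%:Z + 1.

(* Interior grid vectors; mxvec enumerates lexicographically. *)
Definition gridvec := 'rV[R[i]]_(nint * nint).

Definition sample (f : R * R -> R[i]) : gridvec :=
  mxvec (\matrix_(a, b) f (point (node a) (node b))).

(* The entries of v indexed by integers, with 0 at all non-interior indices. *)
Definition ext0 (v : gridvec) (i j : int) : R[i] :=
  match [pick a | node a == i], [pick b | node b == j] with
  | Some a, Some b => vec_mx v a b
  | _, _ => 0
  end.

Definition l2norm (v : gridvec) : R :=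
  Num.sqrt (mesh ^+ 2 * \sum_k ComplexField.Normc.normc (v 0 k) ^+ 2).

Definition linfnorm (v : gridvec) : R :=
  \big[Num.max/0]_k ComplexField.Normc.normc (v 0 k).

Definition cell (i j : int) : set (R * R) :=
  [set z | (i%:~R * mesh <= z.1 <= (i + 1)%:~R * mesh) &&
           (j%:~R * mesh <= z.2 <= (j + 1)%:~R * mesh)].

(* The bilinear interpolant on cell i j of the corner values w. *)
Definition bilin_interp (w : int -> int -> R[i]) (i j : int) (z : R * R) : R[i] :=
  let s := (z.1 - i%:~R * mesh) / mesh in
  let t := (z.2 - j%:~R * mesh) / mesh in
  ((1 - s) * (1 - t))%:C * w i j + (s * (1 - t))%:C * w (i + 1) j +
  ((1 - s) * t)%:C * w i (j + 1) + (s * t)%:C * w (i + 1) (j + 1).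

Variables (beta gamma sigma : R).

Definition ksigma : R := if sigma == 2 then 4 / 3 else 1.

Definition W00 : R :=
  int2 (cell 0 0)
    (fun z => (z.1 ^+ 2 + z.2 ^+ 2) `^ ((sigma - 2 - beta) / 2)).

Definition idist (a b : int) : R :=
  mesh * Num.sqrt (a%:~R ^+ 2 + b%:~R ^+ 2).

Definition phi (u : int -> int -> R[i]) (p q a b : int) : R[i] :=
  (u (p + a) (q + b) + u (p - a) (q + b) + u (p - a) (q - b) +
   u (p + a) (q - b) - 4 * u p q) /
  (expR (gamma * idist a b) * idist a b `^ sigma)%:C.

Definition near_cell (p q i j : int) : bool :=
  (i, j) \in [:: (p, q); (p - 1, q); (p, q - 1); (p - 1, q - 1)].

Definition kernel2 (p q : int) (z : R * R) : R :=
  ((z.1 - (point p q).1) ^+ 2 + (z.2 - (point p q).2) ^+ 2)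
    `^ (- ((2 + beta) / 2)).

Definition cell_int (u : int -> int -> R[i]) (p q i j : int) : R[i] :=
  let w i' j' :=
    (u i' j' - u p q) * (expR (- (gamma * idist (i' - p) (j' - q))))%:C in
  cint2 (cell i j) (fun z => bilin_interp w i j z * (kernel2 p q z)%:C).

Definition Winfty (p q : int) : R :=
  int2 (~` square l)
    (fun z => expR (- (gamma * eucl_dist z (point p q))) * kernel2 p q z).

Definition discrete_at (u : int -> int -> R[i]) (p q : int) : R[i] :=
  (c2 beta gamma)%:C *
  ((ksigma / 4 * W00)%:C * (phi u p q 0 1 + phi u p q 1 0 + phi u p q 1 1) +
   \sum_(a < N.*2) \sum_(b < N.*2 |
       ~~ near_cell p q ((a : nat)%:Z - N%:Z) ((b : nat)%:Z - N%:Z))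
     cell_int u p q ((a : nat)%:Z - N%:Z) ((b : nat)%:Z - N%:Z) -
   (Winfty p q)%:C * u p q).

Definition discrete_laplacian (v : gridvec) : gridvec :=
  mxvec (\matrix_(a, b) discrete_at (ext0 v) (node a) (node b)).

End Grid.

(* Main.v *)
Require Import Defs.
From mathcomp Require Import all_boot all_order all_algebra.
From mathcomp Require Import complex.
From mathcomp Require Import all_classical all_reals all_analysis.
From mathcomp Require Import measurable_realfun.
From mathcomp Require Import zify ring lra.

Import Order.TTheory GRing.Theory Num.Theory.
Import numFieldNormedType.Exports.

Local Open Scope classical_set_scope.
Local Open Scope ring_scope.
Local Open Scope complex_scope.

(* At a grid node x the error splits into a near part, over the square Q of the
   four cells around x, and a far part. On Q the principal value is symmetrised
   over the four reflections about x: the integrand becomes a second difference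
   of G, O(r^2), against r^(-2-beta), so the limit exists and is O(h^(2-beta));
   the discrete near term has the same size by the same bound, whatever the value
   of k_sigma. Off Q the contribution of the complement of Omega cancels exactly
   against W^oo G(x), and on each cell the bilinear interpolant of
   (G(y) - G(x)) exp(-gamma |x - y|) is off by O(h^2); since the integral of
   r^(-2-beta) off Q is O(h^(-beta)), the far part is again O(h^(2-beta)). The
   constant c_(2,beta) only enters as a factor. *)

(** * Power weights on the plane *)

(** The constant must be uniform over the nodes, although some of them are at distance h from the
    boundary of Omega, across which G need not be differentiable. What makes this possible is that
    the box of radius h about an interior node stays inside the closed square, so that every second
    difference and every interpolation is taken along axis-parallel segments of that square. A
    second obstacle is that for gamma > 0 the function exp(-gamma |x - y|) is not C^2 at y = x: its
    second derivatives grow like 1/r. The O(h^2) interpolation error therefore cannot come from a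
    C^2 bound on the product. It comes from a weighted estimate, in which the Lipschitz bound |G(y)
    - G(x)| = O(r) pays for the loss. In the discrete near term, the difference quotients are
    O(h^(2-sigma)) and W_(0,0) is O(h^(sigma-beta)), so sigma drops out of the rate. The kernel and
    the truncation of the principal value are Euclidean, while grid regions are squares. The
    comparison of the two distances costs only factors of 2. *)

Local Notation plane R := (measurableTypeR R * measurableTypeR R)%type.
Local Notation mu2 R :=
  (@lebesgue_measure R \x @lebesgue_measure R : {measure set plane R -> \bar R})%E.

Section PlaneIntegrals.
Variable R : realType.
Implicit Types (x y z : plane R) (a c q r s t : R) (D : set (plane R)).

Lemma exists_lt_expr2 t : exists n, t < 2 ^+ n.
Proof.
exists (Num.bound t); have [t0|t0] := leP t 0; first exact: le_lt_trans t0 (exprn_gt0 _ _).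
apply: lt_trans (archi_boundP (ltW t0)) _.
by rewrite -natrX ltr_nat ltn_expl.
Qed.

(** The sup distance: its closed balls are squares, and the one of radius [h] about a node is the
    union of the four cells around it. *)
Definition dmax x y : R := Num.max `|x.1 - y.1| `|x.2 - y.2|.

Definition box x r : set (plane R) := [set y | dmax x y <= r].

Lemma dmax_ge0 x y : 0 <= dmax x y.
Proof. by rewrite /dmax le_max normr_ge0. Qed.

Lemma dist_sqr x y : eucl_dist x y ^+ 2 = (x.1 - y.1) ^+ 2 + (x.2 - y.2) ^+ 2.
Proof. by rewrite /eucl_dist sqr_sqrtr// addr_ge0// sqr_ge0. Qed.

Lemma dist_ge0 x y : 0 <= eucl_dist x y.
Proof. exact: sqrtr_ge0. Qed.

Lemma dmax_le_dist x y : dmax x y <= eucl_dist x y.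
Proof.
rewrite /dmax ge_max -!sqrtr_sqr !ler_sqrt ?addr_ge0 ?sqr_ge0//.
by rewrite lerDl lerDr !sqr_ge0.
Qed.

Lemma dist_le_dmax x y : eucl_dist x y <= 2 * dmax x y.
Proof.
rewrite -(@ler_pXn2r _ 2)// ?nnegrE ?dist_ge0 ?mulr_ge0 ?dmax_ge0// dist_sqr.
have h1 : `|x.1 - y.1| <= dmax x y by rewrite /dmax le_max lexx.
have h2 : `|x.2 - y.2| <= dmax x y by rewrite /dmax le_max lexx orbT.
rewrite -(real_normK (num_real (x.1 - y.1))) -(real_normK (num_real (x.2 - y.2))).
have n1 := normr_ge0 (x.1 - y.1); have n2 := normr_ge0 (x.2 - y.2).
have := dmax_ge0 x y; nra.
Qed.

Lemma measurable_dist x : measurable_fun setT (fun y : plane R => eucl_dist x y).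
Proof.
have ms : measurable_fun setT (@Num.sqrt R).
  apply: continuous_measurable_fun; exact: sqrt_continuous.
apply: (measurableT_comp ms); apply: measurable_funD; apply: measurable_funX;
  exact: measurable_funB.
Qed.

Lemma measurable_dist_powR x a :
  measurable_fun setT (fun y : plane R => eucl_dist x y `^ a).
Proof.
apply: (@measurableT_comp _ _ _ _ _ _ (@powR R ^~ a)); last exact: measurable_dist.
exact: measurable_powR.
Qed.

Lemma measurable_setX_itv (i j : interval R) :
  measurable ([set` i] `*` [set` j] : set (plane R)).
Proof. by apply: measurableX; exact: measurable_itv. Qed.

Lemma boxE x r :
  box x r = [set` `[x.1 - r, x.1 + r]] `*` [set` `[x.2 - r, x.2 + r]].
Proof.
apply/seteqP; split => y; rewrite /box/= /dmax ge_max !in_itv/= !ler_distl.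
  by move=> /andP[/andP[? ?] /andP[? ?]]; split; lra.
by move=> [/andP[? ?] /andP[? ?]]; lra.
Qed.

Lemma measurable_box x r : measurable (box x r).
Proof. rewrite boxE; exact: measurable_setX_itv. Qed.

Lemma box_measure x r : 0 <= r -> mu2 R (box x r) = (4 * r ^+ 2)%:E.
Proof.
move=> r0; rewrite boxE.
rewrite [LHS](product_measure1E lebesgue_measure lebesgue_measure);
  [|exact: measurable_itv..].
have E (t : R) : lebesgue_measure [set` `[t - r, t + r]] = (2 * r)%:E.
  rewrite lebesgue_measure_itv/= lte_fin.
  have [r1|r1] := ltP 0 r; last first.
    have -> : r = 0 by apply/eqP; rewrite eq_le r0 r1.
    by rewrite subr0 addr0 ltxx mulr0.
  by rewrite ifT; [rewrite -EFinB; congr EFin; ring|lra].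
rewrite [X in (X * _)%E](E x.1) [X in (_ * X)%E](E x.2) -EFinM.
by congr EFin; ring.
Qed.

Lemma ler_powR_neg a s t : a <= 0 -> 0 < s -> s <= t -> t `^ a <= s `^ a.
Proof.
move=> a0 s0 st; have t0 := lt_le_trans s0 st.
have E u : u `^ a = (u `^ (- a))^-1 by rewrite powRN invrK.
rewrite !E lef_pV2 ?posrE ?powR_gt0//.
by apply: (@ge0_ler_powR R (- a) _ s t _ _ st); rewrite ?nnegrE ?oppr_ge0// ltW.
Qed.

Lemma geometric_nneseries_le a q (ha : 0 <= a) : 0 <= q < 1 ->
  (\sum_(0 <= k <oo) (a * q ^+ k)%:E <= (a / (1 - q))%:E)%E.
Proof.
move=> /andP[q0 q1]; apply: lime_le.
  by apply: is_cvg_nneseries => k _ _; rewrite lee_fin mulr_ge0// exprn_ge0.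
near=> n; rewrite sumEFin lee_fin.
have := geometric_seriesE a (negbT (lt_eqF q1)).
move=> /(congr1 (fun f => f n)); rewrite /series /geometric/= => ->.
by rewrite ler_pM2r ?invr_gt0 ?subr_gt0// ler_piMr// gerBl exprn_ge0.
Unshelve. all: by end_near. Qed.

(* The annuli [c q^k <= dmax x y <= 2 c q^k] cover D up to x (where the weight is
   0, as 0 `^ a = 0), and the k-th one carries at most 16 (c q^k)^(2 + a). *)
Lemma shell_integral_le x D a q c : measurable D -> a < 0 -> 0 < c -> 0 < q ->
  q `^ (2 + a) < 1 ->
  (forall y, D y -> 0 < dmax x y ->
     exists k, c * q ^+ k <= dmax x y <= 2 * (c * q ^+ k)) ->
  (\int[mu2 R]_(y in D) (eucl_dist x y `^ a)%:E <=
     (16 * c `^ (2 + a) / (1 - q `^ (2 + a)))%:E)%E.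
Proof.
move=> mD a0 c0 q0 qa hD.
pose t k := c * q ^+ k.
have t0 k : 0 < t k by rewrite mulr_gt0// exprn_gt0.
(* On the [k]-th shell the weight is at most [t k ^ a], as [a] is negative and the Euclidean
   distance is at least [dmax]. Putting this value on a whole box makes the boxes overlap, which is
   harmless for an upper bound. *)
pose f k y := (t k `^ a * \1_(box x (2 * t k)) y)%:E.
have f0 k y : (0 <= f k y)%E by rewrite lee_fin mulr_ge0// powR_ge0.
have mf k : measurable_fun D (f k).
  apply/measurable_EFinP; apply: measurable_funM => //.
  by apply: measurable_indic; exact: measurable_box.
apply: (@le_trans _ _ (\int[mu2 R]_(y in D) \sum_(0 <= k <oo) f k y)%E).
  apply: ge0_le_integral => //.
  - by move=> y _; rewrite lee_fin powR_ge0.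
  - by apply/measurable_EFinP; apply: measurable_funTS; exact: measurable_dist_powR.
  - by apply: ge0_emeasurable_sum => // k y _ _; exact: f0.
  move=> y Dy; have [d0|d0] := ltP 0 (dmax x y); last first.
    have -> : eucl_dist x y = 0.
      apply/eqP; rewrite eq_le dist_ge0 andbT (le_trans (dist_le_dmax x y))//.
      by rewrite pmulr_rle0.
    by rewrite powR0 ?lt_eqF//; exact: nneseries_ge0.
  have [k /andP[k1 k2]] := hD y Dy d0.
  apply: (@le_trans _ _ (f k y)).
    rewrite /f lee_fin indicE mem_set ?mulr1; last by rewrite /box/=.
    apply: ler_powR_neg => //; first exact: ltW.
    exact: le_trans k1 (dmax_le_dist x y).
  apply: le_trans (nneseries_lim_ge k.+1 _); last by move=> n _ _; exact: f0.
  by rewrite big_nat_recr//= leeDr// sume_ge0.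
rewrite integral_nneseries//.
apply: (@le_trans _ _ (\sum_(0 <= k <oo)
   (16 * c `^ (2 + a) * (q `^ (2 + a)) ^+ k)%:E)%E); last first.
  by apply: geometric_nneseries_le; rewrite ?mulr_ge0 ?powR_ge0.
apply: lee_nneseries => k _; first by move=> _; exact: integral_ge0.
rewrite /f; under eq_integral do rewrite EFinM.
rewrite ge0_integralZl_EFin ?powR_ge0//; last first.
  by apply/measurable_EFinP; apply: measurable_indic; exact: measurable_box.
rewrite integral_indic//; last exact: measurable_box.
apply: (@le_trans _ _ ((t k `^ a)%:E * mu2 R (box x (2 * t k)))%E).
  apply: lee_pmul => //; first by rewrite lee_fin powR_ge0.
  by apply: le_measure; rewrite ?inE//; [apply: measurableI => //|]; exact: measurable_box.
rewrite box_measure; last by rewrite mulr_ge0// ltW.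
rewrite -EFinM lee_fin le_eqVlt.
apply/orP; left; apply/eqP.
have tk2 : (t k) ^+ 2 = t k `^ 2 by rewrite powR_mulrn// ltW.
have -> : t k `^ a * (4 * (2 * t k) ^+ 2) = 16 * (t k `^ 2 * t k `^ a).
  by rewrite -tk2; ring.
rewrite -powRD; last by apply/implyP => _; rewrite gt_eqF.
rewrite {1}/t powRM ?exprn_ge0 ?ltW//.
have -> : (q ^+ k) `^ (2 + a) = (q `^ (2 + a)) ^+ k.
  by rewrite -(powR_mulrn k (ltW q0)) -(powR_mulrn k (powR_ge0 _ _)) -!powRrM mulrC.
by rewrite mulrA.
Qed.

(** The shells shrink towards [x] with ratio 1/2, starting from [r / 2]; their contributions are
    summable because [2 + a] is positive. *)
Lemma near_integral_le a : -2 < a < 0 -> exists2 C, 0 < C & forall x r, 0 < r ->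
  (\int[mu2 R]_(y in box x r) (eucl_dist x y `^ a)%:E <= (C * r `^ (2 + a))%:E)%E.
Proof.
move=> /andP[a2 a0]; pose Q : R := 2^-1 `^ (2 + a).
have Q1 : Q < 1.
  rewrite -[X in _ < X](_ : 1 `^ (2 + a) = 1); last by rewrite powR1.
  apply: (@gt0_ltr_powR _ (2 + a)); rewrite ?nnegrE; lra.
exists (16 * Q / (1 - Q)); first by rewrite !mulr_gt0 ?invr_gt0 ?subr_gt0 ?powR_gt0.
move=> x r r0.
have -> : 16 * Q / (1 - Q) * r `^ (2 + a) = 16 * (r / 2) `^ (2 + a) / (1 - Q).
  rewrite powRM ?invr_ge0 ?ltW// /Q; ring.
apply: shell_integral_le => //; [exact: measurable_box|by rewrite divr_gt0|].
move=> y; rewrite /box/= => yr y0.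
have exn : exists n, r * 2^-1 ^+ n < dmax x y.
  have [n hn] := exists_lt_expr2 (r / dmax x y).
  exists n; rewrite exprVn ltr_pdivrMr ?exprn_gt0// mulrC -ltr_pdivrMr//.
(* The least [n] with [r / 2 ^ n] below the distance is positive, and its predecessor is the index
   of the shell. *)
case: (ex_minnP exn) => -[|n] hn nmin.
  by move: hn; rewrite expr0 mulr1 ltNge yr.
exists n; rewrite mulrAC -mulrA -exprSr ltW//=.
rewrite exprS; have -> : 2 * (r * (2^-1 * 2^-1 ^+ n)) = r * 2^-1 ^+ n :> R by field.
by rewrite leNgt; apply/negP => /nmin; rewrite ltnn.
Qed.

(** The shells now double outwards from [r], and [2 + a < 0] makes the ratio of the series less than
    1. *)
Lemma far_integral_le a : a < -2 -> exists2 C, 0 < C & forall x r, 0 < r ->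
  (\int[mu2 R]_(y in ~` box x r) (eucl_dist x y `^ a)%:E <= (C * r `^ (2 + a))%:E)%E.
Proof.
move=> a2; pose Q : R := 2 `^ (2 + a).
have Q1 : Q < 1.
  rewrite /Q -(opprK (2 + a)) powRN invf_lt1 ?powR_gt0//.
  rewrite -[X in X < _](_ : 1 `^ (- (2 + a)) = 1); last by rewrite powR1.
  apply: (@gt0_ltr_powR _ (- (2 + a))); rewrite ?nnegrE; lra.
exists (16 / (1 - Q)); first by rewrite !mulr_gt0 ?invr_gt0 ?subr_gt0 ?powR_gt0.
move=> x r r0; rewrite mulrAC; apply: shell_integral_le => //.
- by apply: measurableC; exact: measurable_box.
- lra.
move=> y; rewrite /box/= => /negP; rewrite -ltNge => yr y0.
have exn : exists n, dmax x y <= r * 2 ^+ n.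
  have [n hn] := exists_lt_expr2 (dmax x y / r).
  by exists n; rewrite mulrC -ler_pdivrMr// ltW.
case: (ex_minnP exn) => -[|n] hn nmin.
  by move: hn; rewrite expr0 mulr1 leNgt yr.
exists n; rewrite mulrCA -exprS hn andbT.
by rewrite leNgt; apply/negP => /ltW/nmin; rewrite ltnn.
Qed.

(** Integrability and the bound are delivered together: [int2] is total, so additivity of integrals
    always has to be justified by the first, and estimates use the second. *)
Lemma Rintegral_dominated D (f : plane R -> R) (v : plane R -> R) (B M : R) :
  measurable D -> measurable_fun setT f -> measurable_fun setT v -> 0 <= M ->
  (forall y, D y -> 0 <= v y) ->
  (forall y, D y -> `|f y| <= M * v y) ->
  (\int[mu2 R]_(y in D) (v y)%:E <= B%:E)%E ->
  (mu2 R).-integrable D (EFin \o f) /\ `|int2 D f| <= M * B.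
Proof.
move=> mD mf mv M0 v0 fv vB.
have iv : (mu2 R).-integrable D (EFin \o (fun y => M * v y)).
  have iv0 : (mu2 R).-integrable D (EFin \o v).
    apply/integrableP; split; first exact/measurable_EFinP/measurable_funTS.
    apply: le_lt_trans (ltry B); apply: le_trans vB.
    rewrite le_eqVlt; apply/orP; left; apply/eqP; apply: eq_integral => y.
    by rewrite inE => Dy /=; rewrite ger0_norm// v0.
  rewrite [X in integrable _ _ X](_ : _ = (fun y => M%:E * (EFin \o v) y)%E)//.
  exact: integrableZl.
have ifm : (mu2 R).-integrable D (EFin \o f).
  apply: le_integrable iv => //; first exact/measurable_EFinP/measurable_funTS.
  move=> y Dy /=; rewrite lee_fin [leRHS]ger0_norm ?fv//.
  by rewrite mulr_ge0// v0.
split=> //; apply: le_trans (le_normr_Rintegral mD ifm) _.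
apply: (@le_trans _ _ (int2 D (fun y => M * v y))).
  apply: le_Rintegral => //.
  exact: (integrable_abse ifm).
rewrite -lee_fin /int2 /Rintegral fineK; last exact: integrable_fin_num.
under eq_integral do rewrite EFinM.
rewrite ge0_integralZl_EFin//; last exact/measurable_EFinP/measurable_funTS.
by rewrite EFinM lee_pmul// ?lee_fin// integral_ge0.
Qed.

(** * Invariance of plane integrals under reflections about a point *)

Definition flip (b : bool) c t : R := if b then 2 * c - t else t.

Definition reflect_plane (b1 b2 : bool) x (y : plane R) : plane R :=
  (flip b1 x.1 y.1, flip b2 x.2 y.2).

Lemma measurable_flip b c :
  measurable_fun setT (flip b c : measurableTypeR R -> measurableTypeR R).
Proof.
have h : measurable_fun setT (fun t : measurableTypeR R => 2 * c - t : R).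
  exact: measurable_funB.
by case: b => //; exact: measurable_id.
Qed.

(** Lebesgue measure is determined by its values on half-open intervals. A reflection moves the
    closed end to the other side but keeps the length. *)
Lemma lebesgue_measure_flip b c (A : set (measurableTypeR R)) : measurable A ->
  lebesgue_measure ((flip b c : measurableTypeR R -> measurableTypeR R) @^-1` A)
    = lebesgue_measure A.
Proof.
case: b => // mA; have mf := measurable_flip true c.
rewrite -[LHS]/(pushforward lebesgue_measure
  (flip true c : measurableTypeR R -> measurableTypeR R) A).
apply/esym/lebesgue_measure_unique => //= _ [[a b]] _ <-.
rewrite /pushforward.
have -> : (flip true c : measurableTypeR R -> measurableTypeR R)
     @^-1` [set` `]a, b]] = [set` `[2 * c - b, 2 * c - a[].
  by apply/seteqP; split => t /=; rewrite !in_itv/=; lra.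
rewrite !lebesgue_measure_itv/= !lte_fin.
have -> : (2 * c - b < 2 * c - a) = (a < b) by lra.
by case: ifP => // _; rewrite -!EFinB; congr EFin; ring.
Qed.

Lemma measurable_reflect b1 b2 x : measurable_fun setT (reflect_plane b1 b2 x).
Proof.
apply/measurable_fun_pairP; split.
- apply: (measurableT_comp (measurable_flip b1 x.1)); exact: measurable_fst.
- apply: (measurableT_comp (measurable_flip b2 x.2)); exact: measurable_snd.
Qed.

Lemma measure_reflect b1 b2 x D : measurable D ->
  mu2 R (reflect_plane b1 b2 x @^-1` D) = mu2 R D.
Proof.
move=> mD; have mf := measurable_reflect b1 b2 x.
rewrite -[LHS]/(pushforward (mu2 R) (reflect_plane b1 b2 x) D).
apply/esym/product_measure_unique => // A B mA mB.
pose A' := (flip b1 x.1 : measurableTypeR R -> measurableTypeR R) @^-1` A.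
pose B' := (flip b2 x.2 : measurableTypeR R -> measurableTypeR R) @^-1` B.
transitivity (mu2 R (A' `*` B')) => //.
have mA' : measurable A' by rewrite -[X in measurable X]setTI; exact: measurable_flip.
have mB' : measurable B' by rewrite -[X in measurable X]setTI; exact: measurable_flip.
rewrite [LHS](product_measure1E lebesgue_measure lebesgue_measure mA' mB').
by rewrite [X in (X * _)%E]lebesgue_measure_flip// [X in (_ * X)%E]lebesgue_measure_flip.
Qed.

Lemma int2_reflect b1 b2 x D (f : plane R -> R) : measurable D ->
  measurable_fun setT f -> reflect_plane b1 b2 x @^-1` D = D ->
  (mu2 R).-integrable D (EFin \o (f \o reflect_plane b1 b2 x)) ->
  int2 D (f \o reflect_plane b1 b2 x) = int2 D f.
Proof.
move=> mD mf eD iD; have ms := measurable_reflect b1 b2 x.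
rewrite /int2 /Rintegral; congr fine.
rewrite -{1}eD.
transitivity (\int[pushforward (mu2 R) (reflect_plane b1 b2 x)]_(y in D) (f y)%:E)%E.
  apply: esym; apply: (integral_pushforward ms (f := EFin \o f)) => //.
    exact/measurable_EFinP.
  by rewrite eD.
by apply: eq_measure_integral => A mA _; exact: measure_reflect.
Qed.

Lemma dist_reflect b1 b2 x y : eucl_dist x (reflect_plane b1 b2 x y) = eucl_dist x y.
Proof.
rewrite /eucl_dist /reflect_plane /flip/=; congr Num.sqrt; congr (_ + _).
  by case: b1 => //; ring.
by case: b2 => //; ring.
Qed.

Lemma box_reflect b1 b2 x r y : box x r (reflect_plane b1 b2 x y) = box x r y.
Proof.
rewrite /box/= /dmax /reflect_plane /flip/=; congr (is_true (Num.max _ _ <= _)).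
  by case: b1 => //; rewrite -normrN; congr (`|_|); ring.
by case: b2 => //; rewrite -normrN; congr (`|_|); ring.
Qed.

End PlaneIntegrals.

(** * Splitting integrals along the grid *)

Section RintegralSum.
Context {d} {T : measurableType d} {R : realType} (mu : {measure set T -> \bar R}).

Lemma integrable_EFin_sum (I : Type) (s : seq I) (P : pred I) (F : I -> T -> R) D :
  measurable D -> (forall i, P i -> mu.-integrable D (EFin \o F i)) ->
  mu.-integrable D (EFin \o (fun z => \sum_(i <- s | P i) F i z)).
Proof.
move=> mD iF; rewrite [X in integrable _ _ X](_ : _ =
  fun z => (\sum_(i <- s | P i) (EFin \o F i) z)%E); first exact: integrable_sum.
by apply/funext => z /=; rewrite sumEFin.
Qed.

Lemma Rintegral_sum (I : Type) (s : seq I) (P : pred I) (F : I -> T -> R) D :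
  measurable D -> (forall i, P i -> mu.-integrable D (EFin \o F i)) ->
  \int[mu]_(z in D) (\sum_(i <- s | P i) F i z) =
  \sum_(i <- s | P i) \int[mu]_(z in D) F i z.
Proof.
move=> mD iF; elim: s => [|i s ih].
  under eq_Rintegral do rewrite big_nil.
  by rewrite big_nil Rintegral_cst// mul0r.
rewrite big_cons -ih; case: ifPn => Pi.
  rewrite -RintegralD//; [|exact: iF|exact: integrable_EFin_sum].
  by apply: eq_Rintegral => z _; rewrite big_cons Pi.
by apply: eq_Rintegral => z _; rewrite big_cons (negbTE Pi).
Qed.

End RintegralSum.

Section GridSplit.
Variables (R : realType) (l : R) (N : nat).
Hypotheses (l0 : 0 < l) (N0 : (0 < N)%N).
Let h := mesh l N.

Lemma mesh_gt0 : 0 < h.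
Proof. by rewrite /h /mesh divr_gt0// ltr0n. Qed.

Lemma meshN : N%:R * h = l.
Proof. by rewrite /h /mesh mulrC divfK// pnatr_eq0 -lt0n. Qed.

Definition grid_pts : set (measurableTypeR R) := range (fun k : int => k%:~R * h : R).

(* The closed cells overlap, but only on these null lines. *)
Definition grid_lines : set (plane R) := grid_pts `*` setT `|` setT `*` grid_pts.

Lemma countable_grid_pts : countable grid_pts.
Proof. exact: card_le_trans (card_image_le _ _) (countableP _). Qed.

Lemma measurable_grid_pts : measurable grid_pts.
Proof. by apply: countable_measurable countable_grid_pts => t; exact: measurable_set1. Qed.

Lemma grid_lines_null : (mu2 R).-negligible grid_lines.
Proof.
have mg := measurable_grid_pts.
have g0 : lebesgue_measure grid_pts = 0%E.
  exact: countable_lebesgue_measure0 countable_grid_pts.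
apply: negligibleU; apply/negligibleP.
- exact: measurableX.
- rewrite [LHS](product_measure1E lebesgue_measure lebesgue_measure)//.
  by rewrite [X in (X * _)%E]g0 mul0e.
- exact: measurableX.
- rewrite [LHS](product_measure1E lebesgue_measure lebesgue_measure)//.
  by rewrite [X in (_ * X)%E]g0 mule0.
Qed.

(** Off the grid lines, all the regions involved are described by the integer parts of the two
    coordinates divided by [h]. This and the next lemmas translate membership into inequalities
    between integers, so that partitioning the plane becomes a matter of integer arithmetic. *)
Lemma grid_cell_floor (t : R) (k : int) : ~ grid_pts t ->
  (k%:~R * h <= t <= (k + 1)%:~R * h) = (k == Num.floor (t / h)).
Proof.
move=> gt; rewrite [RHS]eq_sym floor_eq ler_pdivlMr ?mesh_gt0// ltr_pdivrMr ?mesh_gt0//.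
congr (_ && _); rewrite le_eqVlt; case: eqVneq => //= e.
by exfalso; apply: gt; exists (k + 1).
Qed.

Lemma grid_lt_floor (t : R) (k : int) : ~ grid_pts t ->
  (k%:~R * h < t) = (k <= Num.floor (t / h)).
Proof.
move=> gt; rewrite floor_ge_int ler_pdivlMr ?mesh_gt0//.
rewrite le_eqVlt; case: eqVneq => //= e.
by exfalso; apply: gt; exists k.
Qed.

Lemma grid_gt_floor (t : R) (k : int) : (t < k%:~R * h) = (Num.floor (t / h) < k).
Proof. by rewrite [RHS]ltNge floor_ge_int -ltNge ltr_pdivrMr ?mesh_gt0. Qed.

Lemma grid_le_floor (t : R) (k : int) : ~ grid_pts t ->
  (t <= k%:~R * h) = (Num.floor (t / h) < k).
Proof. by move=> gt; rewrite leNgt grid_lt_floor// -ltNge. Qed.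

Lemma grid_ge_floor (t : R) (k : int) : (k%:~R * h <= t) = (k <= Num.floor (t / h)).
Proof. by rewrite leNgt grid_gt_floor -leNgt. Qed.

Definition near_floor (p q i j : int) : bool :=
  (p - 1 <= i < p + 1) && (q - 1 <= j < q + 1).

Lemma near_cellE (p q i j : int) : near_cell p q i j = near_floor p q i j.
Proof.
rewrite /near_cell /near_floor !inE !xpair_eqE.
apply/idP/idP; lia.
Qed.

Lemma box_floor (p q : int) z : ~ grid_lines z ->
  box R (Defs.point l N p q) h z <->
  near_floor p q (Num.floor (z.1 / h)) (Num.floor (z.2 / h)).
Proof.
move=> gz; have g1 : ~ grid_pts z.1 by move=> g; apply: gz; left.
have g2 : ~ grid_pts z.2 by move=> g; apply: gz; right.
have E (t : R) (k : int) : ~ grid_pts t ->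
    (`|k%:~R * h - t| <= h) = (k - 1 <= Num.floor (t / h) < k + 1).
  move=> gt; rewrite -grid_ge_floor -grid_le_floor// intrB intrD mulrBl mulrDl mul1r.
  by rewrite ler_distl; lra.
by rewrite /box/= /dmax ge_max /Defs.point/= -/h !E.
Qed.

Lemma square_floor z : ~ grid_lines z ->
  square l z <-> (- N%:Z <= Num.floor (z.1 / h) < N%:Z)
              && (- N%:Z <= Num.floor (z.2 / h) < N%:Z).
Proof.
move=> gz; have g1 : ~ grid_pts z.1 by move=> g; apply: gz; left.
have g2 : ~ grid_pts z.2 by move=> g; apply: gz; right.
rewrite -!grid_lt_floor// -!grid_gt_floor !mulrNz !mulNr /square/=.
by rewrite -!pmulrn meshN.
Qed.

Lemma cell_floor (i j : int) z : ~ grid_lines z ->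
  cell l N i j z <-> (i == Num.floor (z.1 / h)) && (j == Num.floor (z.2 / h)).
Proof.
move=> gz; have g1 : ~ grid_pts z.1 by move=> g; apply: gz; left.
have g2 : ~ grid_pts z.2 by move=> g; apply: gz; right.
by rewrite /cell/= -/h !grid_cell_floor.
Qed.

Lemma cellE (i j : int) : cell l N i j =
  [set` `[i%:~R * h, (i + 1)%:~R * h]] `*` [set` `[j%:~R * h, (j + 1)%:~R * h]].
Proof.
apply/seteqP; split => z; rewrite /cell/= -/h !in_itv/=; first by move=> /andP.
by move=> [-> ->].
Qed.

Lemma measurable_cell (i j : int) : measurable (cell l N i j : set (plane R)).
Proof. rewrite cellE; exact: measurable_setX_itv. Qed.

Lemma squareE : square l = [set` `]-l, l[] `*` [set` `]-l, l[].
Proof.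
apply/seteqP; split => z; rewrite /square/= !in_itv/=; first by move=> /andP.
by move=> [-> ->].
Qed.

Lemma measurable_square : measurable (square l : set (plane R)).
Proof. rewrite squareE; exact: measurable_setX_itv. Qed.

Section Sum.
Variables (p q : int).
Hypotheses (hp : - N%:Z < p < N%:Z) (hq : - N%:Z < q < N%:Z).
Let x : plane R := Defs.point l N p q.
Let ix (a : 'I_N.*2) : int := (a : nat)%:Z - N%:Z.

(** A far cell has sup distance at least [h] from the node, but being closed it may touch the box of
    radius [h]. The radius [h / 2] gives one open set that contains all far regions and on which the
    kernel is integrable. *)
Lemma far_cell_sub (i j : int) : ~~ near_cell p q i j ->
  cell l N i j `<=` ~` box R x (h / 2).
Proof.
have h0 := mesh_gt0.
have sep (k m : int) (t : R) : (k < m - 1) || (m < k) ->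
    k%:~R * h <= t <= (k + 1)%:~R * h -> `|m%:~R * h - t| <= h / 2 -> False.
  move=> /orP[km|km]; rewrite ler_distl => /andP[kt tk] /andP[tm mt].
    have : (k + 1)%:~R * h <= (m - 1)%:~R * h :> R.
      by rewrite ler_pM2r// ler_int; lia.
    rewrite intrB mulrBl mul1r; lra.
  have : (m + 1)%:~R * h <= k%:~R * h :> R by rewrite ler_pM2r// ler_int; lia.
  rewrite intrD mulrDl mul1r; lra.
rewrite near_cellE /near_floor negb_and => nij z /andP[z1 z2].
rewrite /box/= /dmax ge_max /x /Defs.point/= => /andP[d1 d2].
case/orP: nij => nij; [apply: (sep i p z.1 _ z1 d1)|apply: (sep j q z.2 _ z2 d2)];
  move: nij; rewrite negb_and -!ltNge; lia.
Qed.

Lemma outside_sub : ~` square l `<=` ~` box R x (h / 2).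
Proof.
have h0 := mesh_gt0.
have inI (m : int) (t : R) : - N%:Z < m < N%:Z -> `|m%:~R * h - t| <= h / 2 ->
    - l < t < l.
  rewrite ler_distl -meshN pmulrn => /andP[m1 m2] /andP[t1 t2].
  have : (m + 1)%:~R * h <= N%:Z%:~R * h :> R by rewrite ler_pM2r// ler_int; lia.
  have : (- N%:Z)%:~R * h <= (m - 1)%:~R * h :> R by rewrite ler_pM2r// ler_int; lia.
  rewrite intrB intrD mulrBl mulrDl mulrNz mulNr mul1r; lra.
move=> z; apply: contra_not; rewrite /box/= /dmax ge_max /x /Defs.point/= -/h.
by move=> /andP[d1 d2]; rewrite /square/= (inI p)// (inI q).
Qed.

(** Each point off the grid lines lies in exactly one cell of the infinite grid; the three cases are
    a cell outside the square, one of the four near cells, and a far cell. *)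
Lemma cell_partition (f : plane R -> R) z : ~ grid_lines z ->
  (f \_ (~` box R x h)) z = (f \_ (~` square l)) z +
   \sum_(a < N.*2) \sum_(b < N.*2 | ~~ near_cell p q (ix a) (ix b))
      (f \_ (cell l N (ix a) (ix b))) z.
Proof.
move=> gz; set i := Num.floor (z.1 / h); set j := Num.floor (z.2 / h).
pose Q := near_floor p q i j.
pose S := (- N%:Z <= i < N%:Z) && (- N%:Z <= j < N%:Z).
have restrE (A : set (plane R)) (b : bool) : (A z <-> b) ->
    (f \_ A) z = if b then f z else 0.
  move=> Ab; rewrite patchE; congr (if _ then _ else _).
  by apply/idP/idP; rewrite inE => /Ab.
rewrite (@restrE (~` box R x h) (~~ Q)); last first.
  by split=> [hb|/negP nb hb]; [apply/negP => /(box_floor p q z gz)|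
     apply: nb; apply/(box_floor p q z gz)].
rewrite (@restrE (~` square l) (~~ S)); last first.
  by split=> [hb|/negP nb hb]; [apply/negP => /(square_floor z gz)|
     apply: nb; apply/(square_floor z gz)].
have cE a b : (f \_ (cell l N (ix a) (ix b))) z =
    if (ix a == i) && (ix b == j) then f z else 0.
  by apply: restrE; exact: cell_floor.
under eq_bigr do under eq_bigr do rewrite cE.
(* As the node is interior, its four neighbouring cells all lie inside the square. *)
have QS : Q -> S by move: hp hq; rewrite /Q /S /near_floor; lia.
have [hS|nS] := boolP S; last first.
  have -> : Q = false by apply/negbTE; move: nS; apply: contraNN.
  rewrite /= big1 ?addr0// => a _; rewrite big1// => b _.
  case: ifP => // /andP[/eqP ia /eqP jb]; exfalso; move: nS.
  by rewrite /S -ia -jb /ix; have := ltn_ord a; have := ltn_ord b; lia.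
have la : (`|(i + N%:Z)%R|%N < N.*2)%N by move: hS; rewrite /S; lia.
have lb : (`|(j + N%:Z)%R|%N < N.*2)%N by move: hS; rewrite /S; lia.
have ea : ix (Ordinal la) = i by move: hS; rewrite /S /ix/=; lia.
have eb : ix (Ordinal lb) = j by move: hS; rewrite /S /ix/=; lia.
have ixI a a' : ix a = ix a' -> a = a'.
  by rewrite /ix => e; apply: val_inj => /=; lia.
rewrite add0r (bigD1 (Ordinal la))//= [X in _ + X]big1 ?addr0; last first.
  move=> a na; rewrite big1// => b _; case: ifP => // /andP[/eqP ia _].
  by move: na; rewrite (ixI a (Ordinal la)) ?eqxx// ia ea.
rewrite ea; have [hQ|nQ] := boolP Q.
  rewrite big1// => b; case: ifP => // /andP[_ /eqP jb].
  by rewrite jb near_cellE -/Q hQ.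
(* Exactly one term of the double sum survives, that of the cell containing [z]. *)
rewrite (bigD1 (Ordinal lb))/=; last by rewrite eb near_cellE.
rewrite eb !eqxx/= big1 ?addr0// => b /andP[_ nb]; case: ifP => // /eqP jb.
by move: nb; rewrite (ixI b (Ordinal lb)) ?eqxx// jb eb.
Qed.

Lemma box_half_sub : ~` box R x h `<=` ~` box R x (h / 2).
Proof.
move=> z; apply: contra_not; rewrite /box/= => /le_trans; apply.
have := mesh_gt0; lra.
Qed.

(** It is applied twice: to the integrand of the principal value, and to the bare kernel, where it
    turns the sum of the cell bounds back into a single integral. *)
Lemma int2_grid_split (f : plane R -> R) :
  (mu2 R).-integrable (~` box R x (h / 2)) (EFin \o f) ->
  int2 (~` box R x h) f = int2 (~` square l) f +
    \sum_(a < N.*2) \sum_(b < N.*2 | ~~ near_cell p q (ix a) (ix b))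
      int2 (cell l N (ix a) (ix b)) f.
Proof.
move=> fi.
have mB r : measurable (~` box R x r) by apply: measurableC; exact: measurable_box.
have mS : measurable (~` square l : set (plane R)).
  by apply: measurableC; exact: measurable_square.
have iD D : measurable D -> D `<=` ~` box R x (h / 2) ->
    (mu2 R).-integrable setT (EFin \o (f \_ D)).
  move=> mD DB; rewrite -restrict_EFin; apply/(integrable_mkcond _ mD).1.
  exact: integrableS fi.
have iB := iD _ (mB _) box_half_sub.
have iS := iD _ mS outside_sub.
have iC (a b : 'I_N.*2) : ~~ near_cell p q (ix a) (ix b) ->
    (mu2 R).-integrable setT (EFin \o (f \_ (cell l N (ix a) (ix b)))).
  by move=> ab; apply: iD; [exact: measurable_cell|exact: far_cell_sub].
have mk D : int2 D f = int2 setT (f \_ D) by exact: Rintegral_mkcond.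
rewrite (mk (~` box R x h)) (mk (~` square l)).
under eq_bigr => a _ do under eq_bigr => b _ do rewrite mk.
have iSC : (mu2 R).-integrable setT (EFin \o (fun z => \sum_(a < N.*2)
    \sum_(b < N.*2 | ~~ near_cell p q (ix a) (ix b))
      (f \_ (cell l N (ix a) (ix b))) z)).
  apply: integrable_EFin_sum => // a _.
  by apply: integrable_EFin_sum => // b; exact: iC.
have -> : \sum_(a < N.*2) \sum_(b < N.*2 | ~~ near_cell p q (ix a) (ix b))
      int2 setT (f \_ (cell l N (ix a) (ix b))) =
    int2 setT (fun z => \sum_(a < N.*2)
      \sum_(b < N.*2 | ~~ near_cell p q (ix a) (ix b))
        (f \_ (cell l N (ix a) (ix b))) z).
  rewrite /int2 [RHS]Rintegral_sum//; last first.
    by move=> a _; apply: integrable_EFin_sum => // b; exact: iC.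
  by apply: eq_bigr => a _; rewrite Rintegral_sum// => b; exact: iC.
rewrite -[RHS](RintegralD _ iS iSC)//.
congr fine; apply: ae_eq_integral => //.
- exact: measurable_int iB.
- apply: (measurable_int (mu2 R)).
  rewrite [X in integrable _ _ X](_ : _ = EFin \o (fun z => (f \_ (~` square l)) z +
    \sum_(a < N.*2) \sum_(b < N.*2 | ~~ near_cell p q (ix a) (ix b))
      (f \_ (cell l N (ix a) (ix b))) z))//.
  exact: (integrableD measurableT iS iSC).
(* On the grid lines neighbouring closed cells overlap and the pointwise identity may fail, so the
   integrands agree only almost everywhere. *)
have [A [mA A0 gA]] := grid_lines_null.
exists A; split => // z /=; apply: contra_notP => nA; rewrite cell_partition//.
by move=> /gA.
Qed.

End Sum.
End GridSplit.

(** * Consequences of the regularity of G *)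

Section Segment.
Variables (R : realType) (f f1 f2 : R -> R) (l M : R).
Hypotheses (M0 : 0 <= M) (cf : {within `[- l, l], continuous f}).
Hypothesis df : forall t, - l < t < l -> is_derive t 1 f (f1 t).
Hypothesis df1 : forall t, - l < t < l -> is_derive t 1 f1 (f2 t).
Hypothesis b1 : forall t, - l < t < l -> `|f1 t| <= M.
Hypothesis b2 : forall t, - l < t < l -> `|f2 t| <= M.

Let mvt (a b : R) : - l <= a -> a < b -> b <= l ->
  exists2 c, a < c < b & f b - f a = f1 c * (b - a).
Proof.
move=> la ab bl; have [||c] := @MVT R f f1 a b ab.
- by move=> t; rewrite in_itv/= => /andP[? ?]; apply: df; lra.
- by apply: continuous_subspaceW cf => t /=; rewrite !in_itv/= => /andP[? ?]; lra.
- by rewrite in_itv/= => cab e; exists c.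
Qed.

Let mvt1 (a b : R) : - l < a -> a < b -> b < l ->
  exists2 c, a < c < b & f1 b - f1 a = f2 c * (b - a).
Proof.
move=> la ab bl; have [||c] := @MVT R f1 f2 a b ab.
- by move=> t; rewrite in_itv/= => /andP[? ?]; apply: df1; lra.
- apply: derivable_within_continuous => t; rewrite in_itv/= => /andP[? ?].
  by have [] := df1 t ltac:(lra).
- by rewrite in_itv/= => cab e; exists c.
Qed.

Lemma segment_lipschitz (a b : R) : - l <= a -> a <= b -> b <= l ->
  `|f b - f a| <= M * (b - a).
Proof.
move=> la; rewrite le_eqVlt => /predU1P[-> _|ab bl]; first by rewrite !subrr normr0 mulr0.
have [c cab ->] := mvt a b la ab bl.
rewrite normrM (ger0_norm (_ : 0 <= b - a)); last by lra.
by apply: ler_wpM2r; [lra|apply: b1; lra].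
Qed.

(** The mean value theorem on either side of the interpolation point [m] gives the error
    [s (1 - s) (b - a) (f1 c2 - f1 c1)]. A third application, to [f1] between [c1] and [c2], stays
    in the open interval even when [a] or [b] is an endpoint, where [f1] need not be a derivative of
    [f]. *)
Lemma segment_interp (a b s : R) : - l <= a -> a <= b -> b <= l -> 0 <= s <= 1 ->
  `|(1 - s) * f a + s * f b - f ((1 - s) * a + s * b)| <= M * (b - a) ^+ 2.
Proof.
move=> la ab bl /andP[s0 s1].
have Mab : 0 <= M * (b - a) ^+ 2 by rewrite mulr_ge0// sqr_ge0.
have [eab|nab] := eqVneq a b.
  rewrite -eab (_ : (1 - s) * a + s * a = a); last by ring.
  by rewrite (_ : _ - _ = 0) ?normr0; [rewrite eab subrr expr0n mulr0|ring].
have {}ab : a < b by rewrite lt_neqAle nab.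
have [es0|ns0] := eqVneq s 0.
  by rewrite es0 !subr0 !mul0r !addr0 !mul1r subrr normr0.
have [es1|ns1] := eqVneq s 1.
  by rewrite es1 !subrr !mul0r !add0r !mul1r subrr normr0.
have {}s0 : 0 < s by rewrite lt_neqAle eq_sym ns0.
have {}s1 : s < 1 by rewrite lt_neqAle ns1.
set m := _ * a + _.
have am : a < m by rewrite /m; nra.
have mb : m < b by rewrite /m; nra.
have [c1 c1am e1] := mvt a m la am (ltW (lt_le_trans mb bl)).
have [c2 c2mb e2] := mvt m b (ltW (le_lt_trans la am)) mb bl.
have c12 : c1 < c2 by lra.
have [c3 c3c e3] := mvt1 c1 c2 ltac:(lra) c12 ltac:(lra).
have -> : (1 - s) * f a + s * f b - f m = s * (1 - s) * (b - a) * (f2 c3 * (c2 - c1)).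
  rewrite -e3.
  have -> : (1 - s) * f a + s * f b - f m = s * (f b - f m) - (1 - s) * (f m - f a).
    by ring.
  by rewrite e1 e2 /m; ring.
have h3 : `|f2 c3| <= M by apply: b2; lra.
have hs : 0 <= s * (1 - s) <= 1 by nra.
rewrite !normrM (ger0_norm (_ : 0 <= s)) ?(ger0_norm (_ : 0 <= 1 - s))
  ?(ger0_norm (_ : 0 <= b - a)) ?(ger0_norm (_ : 0 <= c2 - c1)); [|lra..].
have : `|f2 c3| * (c2 - c1) <= M * (b - a).
  by apply: ler_pM => //; lra.
have : s * (1 - s) * (b - a) <= b - a by nra.
have : 0 <= s * (1 - s) * (b - a) by nra.
have : 0 <= `|f2 c3| * (c2 - c1) by rewrite mulr_ge0//; lra.
rewrite expr2; nra.
Qed.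

End Segment.

(** * Axis-parallel slices, and Borel sets of the plane *)

Section PlaneTopology.
Variable R : realType.

Definition slice (b : bool) (c t : R) : R * R := if b then (c, t) else (t, c).

(** The difference quotient of the slice and the directional one of [g] are the same function. *)
Lemma is_derive_slice (b : bool) (g : R * R -> R) (c t : R) :
  derivable g (slice b c t) (axis R b) ->
  is_derive t 1 (fun s => g (slice b c s)) ('D_(axis R b) g (slice b c t)).
Proof.
move=> dg.
have E : (fun h : R => h^-1 *: (((fun s => g (slice b c s)) \o shift t) (h *: (1 : R))
            - g (slice b c t))) =
         (fun h : R => h^-1 *: ((g \o shift (slice b c t)) (h *: axis R b)
            - g (slice b c t))).
  apply/funext => h /=; congr (_ *: (g _ - _)).
  by case: (b); rewrite /slice /axis/=; congr (_, _);
    rewrite /= ?scaler0 ?add0r.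
by split; rewrite /derivable /derive E.
Qed.

Lemma continuous_slice (b : bool) (c : R) : continuous (slice b c : R -> R * R).
Proof.
by move=> t; case: b; [exact: (cvg_pair (cvg_cst c) cvg_id)|exact: (cvg_pair cvg_id (cvg_cst c))].
Qed.

(** Measurability in the plane refers to the product sigma-algebra, so an open set is first written
    as a countable union of boxes with rational centres and radii [1 / (k + 1)]. *)
Lemma open_measurable_plane (U : set (R * R)) : open U -> measurable (U : set (plane R)).
Proof.
move=> oU.
pose B (i : rat * rat * nat) : set (plane R) := box R (ratr i.1.1, ratr i.1.2) i.2.+1%:R^-1.
pose I := [set i | B i `<=` U].
have BE i y : B i y <-> (`|ratr i.1.1 - y.1| <= i.2.+1%:R^-1 /\ `|ratr i.1.2 - y.2| <= i.2.+1%:R^-1).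
  by rewrite /B /box/= /dmax ge_max; split=> [/andP//|[-> ->]].
have mB i : measurable (B i) by exact: measurable_box.
have -> : U = \bigcup_(i in I) B i.
  apply/seteqP; split => [z Uz|z [i iI /iI//]].
  have /nbhs_ballP[e/= e0 zU] : nbhs z U by exact: open_nbhs_nbhs.
  (* Half of [e] suffices: the box has its centre within [1 / (k + 1)] of [z], so its points are
     within twice that. *)
  have [k k0 ke] : exists2 k : nat, True & k.+1%:R^-1 < e / 2.
    exists (Num.bound (e / 2)^-1) => //.
    rewrite invf_plt ?posrE ?divr_gt0//.
    apply: lt_trans (archi_boundP _) _; first by rewrite invr_ge0 divr_ge0// ltW.
    by rewrite ltr_nat.
  have k0' : (0 : R) < k.+1%:R^-1 by rewrite invr_gt0 ltr0n.
  have rap (r t : R) : 0 < r -> exists q : rat, `|ratr q - t| < r.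
    move=> r0; have [q] := @rat_in_itvoo R (t - r) (t + r) ltac:(lra).
    by rewrite in_itv/= => ?; exists q; rewrite ltr_distl.
  have [[q1 h1] [q2 h2]] := (rap _ z.1 k0', rap _ z.2 k0').
  exists (q1, q2, k); last by apply/BE; rewrite /= !ltW.
  move=> y /BE/= [y1 y2]; apply: zU.
  move: h1 h2 y1 y2 ke; move: (k.+1%:R^-1 : R) => r.
  by split; rewrite /ball/= ltr_distl; move: h1 h2 y1 y2;
    rewrite !(ltr_distl, ler_distl); lra.
rewrite bigcup_mkcond; apply: countable_bigcupT_measurable.
  exact: countableP.
by move=> i; case: ifP.
Qed.

(** Measurability is checked separately on [U], where preimages of open intervals are open, and on
    its complement, where [g] is 0. *)
Lemma measurable_within_open (U : set (R * R)) (g : R * R -> R) : open U ->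
  {in U, continuous g} -> (forall z, ~ U z -> g z = 0) ->
  measurable_fun setT (g : plane R -> R).
Proof.
move=> oU cg g0; have mU := open_measurable_plane U oU.
rewrite -(setUv U); apply/measurable_funU => //; first exact: measurableC.
split; last first.
  have mc : measurable_fun (~` U : set (plane R)) (cst 0 : plane R -> R).
    exact: measurable_cst.
  by apply: eq_measurable_fun mc => z; rewrite inE => /g0 ->.
apply: (measurability _ (RGenOpens.measurableE R)).
move=> _ [_ [a [b ->] <-]]; apply: open_measurable_plane.
rewrite openE => z [Uz gz]; apply: filterI; first exact: open_nbhs_nbhs.
by apply: cg; [rewrite inE|apply: open_nbhs_nbhs; split => //; exact: interval_open].
Qed.

End PlaneTopology.

Section Regularity.
Variables (R : realType) (l : R).
Hypothesis l0 : 0 < l.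

(* Only pure second derivatives are needed, hence the one-dimensional
   interpolation bound on axis-parallel segments; on the edges of the square,
   where G need not have derivatives, it holds because G vanishes. *)
Record tame (M : R) (g : R * R -> R) : Prop := Tame {
  tame_ge0 : 0 <= M;
  tame_measurable : measurable_fun setT (g : plane R -> R);
  tame_outside : forall z, ~ square l z -> g z = 0;
  tame_bound : forall z, `|g z| <= M;
  tame_lipschitz : forall b c t u, `|c| <= l -> - l <= t -> t <= u -> u <= l ->
    `|g (slice R b c u) - g (slice R b c t)| <= M * (u - t);
  tame_interp : forall b c t u s,
    `|c| <= l -> - l <= t -> t <= u -> u <= l -> 0 <= s <= 1 ->
    `|(1 - s) * g (slice R b c t) + s * g (slice R b c u)
      - g (slice R b c ((1 - s) * t + s * u))| <= M * (u - t) ^+ 2 }.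

Lemma open_square : open (square l : set (R * R)).
Proof.
rewrite openE => z /andP[/andP[z1 z2] /andP[z3 z4]].
pose e := Num.min (Num.min (z.1 + l) (l - z.1)) (Num.min (z.2 + l) (l - z.2)).
have e0 : 0 < e by rewrite /e !lt_min; lra.
apply/nbhs_ballP; exists e => // y [y1 y2].
move: y1 y2; rewrite /ball/= /e !lt_min !ltr_norml /square/=; lra.
Qed.

Lemma closed_square : closure (square l) = [set` `[- l, l]] `*` [set` `[- l, l]].
Proof.
apply/seteqP; split => z.
  move=> clz; split; rewrite /= in_itv/=; apply/negPn/negP => nz.
    pose e := Num.max (- l - z.1) (z.1 - l).
    have e0 : 0 < e by rewrite /e lt_max; lra.
    have [|y [/andP[/andP[y1 y2] _] [b1 _]]] := clz (ball z e); first exact: nbhsx_ballx.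
    move: b1; rewrite /ball/= /e lt_max !ltr_norml; lra.
  pose e := Num.max (- l - z.2) (z.2 - l).
  have e0 : 0 < e by rewrite /e lt_max; lra.
  have [|y [/andP[_ /andP[y1 y2]] [_ b1]]] := clz (ball z e); first exact: nbhsx_ballx.
  move: b1; rewrite /ball/= /e lt_max !ltr_norml; lra.
rewrite /= !in_itv/= => -[/andP[z1 z2] /andP[z3 z4]] B /nbhs_ballP[e/= e0 zB].
(* Contracting towards the origin by [1 - d] moves a point of the closed square into the open one,
   by less than [e] in each coordinate. *)
pose d := Num.min 1 (e / (2 * l)).
have d0 : 0 < d by rewrite /d lt_min ltr01 divr_gt0// mulr_gt0.
have d1 : d <= 1 by rewrite /d ge_min lexx.
have de : d * l < e.
  have : d <= e / (2 * l) by rewrite /d ge_min lexx orbT.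
  by rewrite ler_pdivlMr ?mulr_gt0//; nra.
have E (t : R) : - l <= t -> t <= l ->
    - l < (1 - d) * t < l /\ `|t - (1 - d) * t| < e.
  move=> t1 t2; have h1 : 0 <= (1 - d) * (l - t) by rewrite mulr_ge0//; lra.
  have h2 : 0 <= (1 - d) * (l + t) by rewrite mulr_ge0//; lra.
  have h3 : 0 <= d * (l - t) by rewrite mulr_ge0//; lra.
  have h4 : 0 <= d * (l + t) by rewrite mulr_ge0//; lra.
  have h5 : 0 < d * l by rewrite mulr_gt0.
  by rewrite ltr_norml; split; lra.
have [[s1 b1] [s2 b2]] := (E _ z1 z2, E _ z3 z4).
by exists ((1 - d) * z.1, (1 - d) * z.2); split; [rewrite /square/= s1 s2|apply: zB].
Qed.

Lemma within_bounded (F : R * R -> R) : {within closure (square l), continuous F} ->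
  exists2 M, 0 < M & forall z, square l z -> `|F z| <= M.
Proof.
move=> cF; have /ex_strict_bound_gt0[k k0 /= kF] : bounded_set (F @` closure (square l)).
  apply: compact_bounded; apply: continuous_compact => //.
  by rewrite closed_square; apply: compact_setX; exact: segment_compact.
exists k => // z sz; apply/ltW/kF; exists z => //.
exact: subset_closure.
Qed.

Lemma C2_tame (g : R * R -> R) : C2_closure_real (square l) g ->
  (forall z, ~ square l z -> g z = 0) -> exists M, tame M g.
Proof.
move=> [cg H1 H2] g0.
have [M0 M00 gM0] := within_bounded g cg.
have B1 b : exists2 M, 0 < M & forall z, square l z -> `|'D_(axis R b) g z| <= M.
  have [_ [F [cF FE]]] := H1 b.
  have [M ? FM] := within_bounded F cF.
  by exists M => // z sz; rewrite -FE//; exact: FM.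
have B2 b : exists2 M, 0 < M & forall z, square l z ->
    `|'D_(axis R b) ('D_(axis R b) g) z| <= M.
  have [_ [F [cF FE]]] := H2 b b.
  have [M ? FM] := within_bounded F cF.
  by exists M => // z sz; rewrite -FE//; exact: FM.
have [[M1 ? gM1] [M2 ? gM2]] := (B1 true, B1 false).
have [[M3 ? gM3] [M4 ? gM4]] := (B2 true, B2 false).
(* One constant for [g], its two first partial derivatives and its two pure second ones. *)
pose M := M0 + M1 + M2 + M3 + M4.
have M_ge0 : 0 <= M by rewrite /M; lra.
have D1 b z : square l z -> `|'D_(axis R b) g z| <= M.
  by move=> sz; case: b; rewrite /M; [have := gM1 z sz|have := gM2 z sz]; lra.
have D2 b z : square l z -> `|'D_(axis R b) ('D_(axis R b) g) z| <= M.
  by move=> sz; case: b; rewrite /M; [have := gM3 z sz|have := gM4 z sz]; lra.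
have sq b c t : - l < c < l -> - l < t < l -> square l (slice R b c t).
  by rewrite /square /slice/=; case: b => /= -> ->.
have nsq b c t : ~~ (- l < c < l) -> ~ square l (slice R b c t).
  by rewrite /square /slice/= => /negP nc; case: b => /= /andP[].
(* Continuity up to the endpoints lets the mean value theorem reach the boundary of the square,
   where no derivative is given. *)
have cs b c : - l < c < l -> {within `[- l, l], continuous (fun t => g (slice R b c t))}.
  move=> hc; apply/subspace_continuousP => t /=; rewrite in_itv/= => ht.
  have clt u : - l <= u <= l -> closure (square l) (slice R b c u).
    rewrite closed_square /slice/= => hu; case: (b) => /=; rewrite !in_itv/=; split=> //;
     lra.
  move/subspace_continuousP : cg => /(_ _ (clt t ht)).
  apply: cvg_comp => A; rewrite /= /within/= => hA.
  change (nbhs t [set u : R | [set` `[- l, l]] u -> A (slice R b c u)]).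
  have hs : nbhs t [set u : R | closure (square l) (slice R b c u) -> A (slice R b c u)].
    exact: (continuous_slice R b c t _ hA).
  apply: filterS hs => u /= Hu.
  by rewrite in_itv/= => hu; apply: Hu; exact: clt.
exists M; split=> //.
- apply: (measurable_within_open R (square l)) => //; first exact: open_square.
  rewrite -continuous_open_subspace; last exact: open_square.
  by apply: continuous_subspaceW cg; exact: subset_closure.
- move=> z; have [sz|nz] := pselect (square l z); last by rewrite g0// normr0.
  by apply: le_trans (gM0 z sz) _; rewrite /M; lra.
- move=> b c t u cl lt tu ul.
  have [hc|nc] := boolP (- l < c < l); last first.
    by rewrite !g0 ?subrr ?normr0; [rewrite mulr_ge0// subr_ge0|exact: nsq..].
  apply: (segment_lipschitz R (fun s => g (slice R b c s))
     (fun s => 'D_(axis R b) g (slice R b c s)) l M (cs b c hc)) => // s hs.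
    by apply: is_derive_slice; apply: (H1 b).1; exact: sq.
  by apply: D1; exact: sq.
- move=> b c t u s cl lt tu ul hs.
  have [hc|nc] := boolP (- l < c < l); last first.
    rewrite !g0 ?subrr ?mulr0 ?addr0 ?subrr ?normr0; [|exact: nsq..].
    by rewrite mulr_ge0// sqr_ge0.
  pose f r := g (slice R b c r); pose f1 r := 'D_(axis R b) g (slice R b c r).
  pose f2 r := 'D_(axis R b) ('D_(axis R b) g) (slice R b c r).
  have h1 r : - l < r < l -> is_derive r 1 f (f1 r).
    by move=> hr; apply: is_derive_slice; apply: (H1 b).1; exact: sq.
  have h2 r : - l < r < l -> is_derive r 1 f1 (f2 r).
    by move=> hr; apply: is_derive_slice; apply: (H2 b b).1; exact: sq.
  have h3 r : - l < r < l -> `|f1 r| <= M by move=> hr; apply: D1; exact: sq.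
  have h4 r : - l < r < l -> `|f2 r| <= M by move=> hr; apply: D2; exact: sq.
  exact: (segment_interp R f f1 f2 l M M_ge0 (cs b c hc) h1 h2 h4 t u s lt tu ul hs).
Qed.

End Regularity.

(** * Bilinear interpolation of the tempered increment *)

Section BilinearError.
Variable R : realType.
Implicit Types (x y z : R * R) (a b c d s t B M gamma l h : R).

Lemma dist_lipschitz x y z :
  `|eucl_dist x y - eucl_dist x z| <= `|y.1 - z.1| + `|y.2 - z.2|.
Proof.
have main u v : eucl_dist x u <= eucl_dist x v + (`|u.1 - v.1| + `|u.2 - v.2|).
  rewrite -(@ler_pXn2r _ 2) ?nnegrE ?addr_ge0 ?dist_ge0// sqrrD !dist_sqr.
  have e1 : x.1 - u.1 = (x.1 - v.1) - (u.1 - v.1) by ring.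
  have e2 : x.2 - u.2 = (x.2 - v.2) - (u.2 - v.2) by ring.
  have /ler_normlP[a1 a2] : `|x.1 - v.1| <= eucl_dist x v.
    by apply: le_trans (dmax_le_dist _ _ _); rewrite /dmax le_max lexx.
  have /ler_normlP[b1 b2] : `|x.2 - v.2| <= eucl_dist x v.
    by apply: le_trans (dmax_le_dist _ _ _); rewrite /dmax le_max lexx orbT.
  rewrite e1 e2; move: a1 a2 b1 b2; set r := eucl_dist x v => a1 a2 b1 b2.
  have n1 : (u.1 - v.1) ^+ 2 = `|u.1 - v.1| ^+ 2 by rewrite real_normK ?num_real.
  have n2 : (u.2 - v.2) ^+ 2 = `|u.2 - v.2| ^+ 2 by rewrite real_normK ?num_real.
  rewrite (sqrrB (x.1 - v.1)) (sqrrB (x.2 - v.2)) n1 n2.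
  have p1 : - (x.1 - v.1) * (u.1 - v.1) <= r * `|u.1 - v.1|.
    rewrite (le_trans (ler_norm _))// normrM normrN ler_wpM2r//.
    by rewrite ler_norml; lra.
  have p2 : - (x.2 - v.2) * (u.2 - v.2) <= r * `|u.2 - v.2|.
    rewrite (le_trans (ler_norm _))// normrM normrN ler_wpM2r//.
    by rewrite ler_norml; lra.
  have := normr_ge0 (u.1 - v.1); have := normr_ge0 (u.2 - v.2).
  move: p1 p2; nra.
have h1 := main y z; have h2 := main z y.
by rewrite ler_norml; rewrite (distrC z.1) (distrC z.2) in h2; lra.
Qed.

(** With [d = b - a] the left side is [exp(-b) (exp d - 1 - d)]. For [d <= 0], [exp(-b) <= 1] and
    [exp d (1 - d) <= 1] suffice. For [d > 0] the factor [exp(-b)] is split as [exp(-a) exp(-d)],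
    and [exp(-d) >= 1 - d] gives [1 - exp(-d) (1 + d) <= d ^ 2]. The constant is thus 1 however
    large [d] is. *)
Lemma expRN_taylor a b : 0 <= a -> 0 <= b ->
  `|expR (- a) - expR (- b) + expR (- b) * (a - b)| <= (a - b) ^+ 2.
Proof.
move=> a0 b0; pose d := b - a.
have ea : expR (- a) = expR (- b) * expR d by rewrite -expRD; congr expR; rewrite /d; ring.
have -> : expR (- a) - expR (- b) + expR (- b) * (a - b) =
    expR (- b) * (expR d - 1 - d) by rewrite ea /d; ring.
have -> : (a - b) ^+ 2 = d ^+ 2 by rewrite /d; ring.
have le1 (u : R) : 0 <= u -> expR (- u) <= 1 by move=> u0; rewrite expR_le1; lra.
have d1 := expR_ge1Dx d; have d2 := expR_ge1Dx (- d).
have eb0 := expR_gt0 (- b); have ed0 := expR_gt0 d.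
rewrite ger0_norm; last by rewrite mulr_ge0//; lra.
have edd : expR d * expR (- d) = 1 by rewrite -expRD subrr expR0.
have [d0|d0] := leP d 0.
  have h : expR d * (1 - d) <= 1 by rewrite -[leRHS]edd ler_pM2l//; lra.
  have : expR d - 1 - d <= d ^+ 2.
    rewrite -(@ler_pM2r _ (1 - d)); [nra|lra].
  have := le1 b b0; nra.
have -> : expR (- b) = expR (- a) * expR (- d).
  by rewrite -expRD; congr expR; rewrite /d; ring.
have h : expR (- d) * (expR d - 1 - d) <= d ^+ 2.
  have : expR (- d) * (expR d - 1 - d) = 1 - expR (- d) * (1 + d) by rewrite -edd; ring.
  nra.
have h0 : 0 <= expR (- d) * (expR d - 1 - d) by rewrite mulr_ge0 ?expR_ge0//; lra.
rewrite -mulrA; have := le1 a a0; have := expR_ge0 (- a); nra.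
Qed.

Lemma expRN_lipschitz a b : 0 <= a -> 0 <= b -> `|expR (- a) - expR (- b)| <= `|a - b|.
Proof.
have main u v : 0 <= u -> u <= v -> expR (- u) - expR (- v) <= v - u.
  move=> u0 uv; have := expR_ge1Dx (u - v).
  have -> : expR (- v) = expR (- u) * expR (u - v) by rewrite -expRD; congr expR; ring.
  have : expR (- u) <= 1 by rewrite expR_le1; lra.
  have := expR_gt0 (- u); nra.
have mon u v : u <= v -> expR (- v) <= expR (- u) by move=> uv; rewrite ler_expR; lra.
move=> a0 b0; have [ab|/ltW ba] := leP a b.
  rewrite (ler0_norm (_ : a - b <= 0)); last by lra.
  by rewrite ger0_norm ?subr_ge0 ?mon// opprB; exact: main.
rewrite (ger0_norm (_ : 0 <= a - b)); last by lra.
by rewrite distrC ger0_norm ?subr_ge0 ?mon//; exact: main.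
Qed.

Definition bil4 s t a b c d : R :=
  (1 - s) * (1 - t) * a + s * (1 - t) * b + (1 - s) * t * c + s * t * d.

(** The four weights are nonnegative and add up to 1. The eight products of a weight with a slack
    [B - a] or [B + a] are what makes the goal linear. *)
Lemma bil4_le s t a b c d B : 0 <= s <= 1 -> 0 <= t <= 1 ->
  `|a| <= B -> `|b| <= B -> `|c| <= B -> `|d| <= B -> `|bil4 s t a b c d| <= B.
Proof.
move=> /andP[s0 s1] /andP[t0 t1] /ler_normlP[a1 a2] /ler_normlP[b1 b2]
  /ler_normlP[c1 c2] /ler_normlP[d1 d2].
have p1 : 0 <= (1 - s) * (1 - t) by rewrite mulr_ge0//; lra.
have p2 : 0 <= s * (1 - t) by rewrite mulr_ge0//; lra.
have p3 : 0 <= (1 - s) * t by rewrite mulr_ge0//; lra.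
have p4 : 0 <= s * t by rewrite mulr_ge0.
have := mulr_ge0 p1 (_ : 0 <= B - a) => /(_ ltac:(lra)).
have := mulr_ge0 p2 (_ : 0 <= B - b) => /(_ ltac:(lra)).
have := mulr_ge0 p3 (_ : 0 <= B - c) => /(_ ltac:(lra)).
have := mulr_ge0 p4 (_ : 0 <= B - d) => /(_ ltac:(lra)).
have := mulr_ge0 p1 (_ : 0 <= B + a) => /(_ ltac:(lra)).
have := mulr_ge0 p2 (_ : 0 <= B + b) => /(_ ltac:(lra)).
have := mulr_ge0 p3 (_ : 0 <= B + c) => /(_ ltac:(lra)).
have := mulr_ge0 p4 (_ : 0 <= B + d) => /(_ ltac:(lra)).
rewrite /bil4 ler_norml; lra.
Qed.

Section Cell.
Variables (l M gamma h : R) (g : R * R -> R) (x : R * R) (X Y s t : R).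
Hypotheses (l0 : 0 < l) (h0 : 0 < h) (g0 : 0 <= gamma) (tg : tame R l M g).
Hypotheses (x1 : `|x.1| <= l) (x2 : `|x.2| <= l).
Hypotheses (X0 : - l <= X) (X1 : X + h <= l) (Y0 : - l <= Y) (Y1 : Y + h <= l).
Hypotheses (s01 : 0 <= s <= 1) (t01 : 0 <= t <= 1).

Let z : R * R := (X + s * h, Y + t * h).
Let bil (f : R * R -> R) := bil4 s t (f (X, Y)) (f (X + h, Y)) (f (X, Y + h)) (f (X + h, Y + h)).
Let r y := eucl_dist x y.
Let E y := expR (- (gamma * r y)).

Let M0 : 0 <= M. Proof. exact: tame_ge0 tg. Qed.

(** The path from [u] to [v] turns at [(v.1, u.2)], which stays in the closed square. *)
Lemma tame_lipschitz2 (u v : R * R) : `|u.1| <= l -> `|u.2| <= l ->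
  `|v.1| <= l -> `|v.2| <= l -> `|g u - g v| <= M * (`|u.1 - v.1| + `|u.2 - v.2|).
Proof.
have lip (b : bool) c a a' : `|c| <= l -> `|a| <= l -> `|a'| <= l ->
    `|g (slice R b c a) - g (slice R b c a')| <= M * `|a - a'|.
  move=> hc /ler_normlP[a1 a2] /ler_normlP[a3 a4].
  have [aa|/ltW aa] := leP a a'.
    rewrite (ler0_norm (_ : a - a' <= 0)) ?opprB; last by lra.
    by rewrite distrC; apply: (tame_lipschitz _ _ _ _ tg) => //; lra.
  rewrite (ger0_norm (_ : 0 <= a - a')); last by lra.
  by apply: (tame_lipschitz _ _ _ _ tg) => //; lra.
case: u v => [u1 u2] [v1 v2]/= hu1 hu2 hv1 hv2.
have -> : g (u1, u2) - g (v1, v2) =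
  (g (slice R false u2 u1) - g (slice R false u2 v1)) +
  (g (slice R true v1 u2) - g (slice R true v1 v2)) by rewrite /slice/=; ring.
by rewrite (le_trans (ler_normD _ _))// mulrDr lerD// lip.
Qed.

Let sh : 0 <= s * h <= h.
Proof.
case/andP: s01 => ? ?; have h1 := ltW h0; rewrite mulr_ge0//=.
by rewrite -[X in _ <= X]mul1r ler_wpM2r.
Qed.

Let th : 0 <= t * h <= h.
Proof.
case/andP: t01 => ? ?; have h1 := ltW h0; rewrite mulr_ge0//=.
by rewrite -[X in _ <= X]mul1r ler_wpM2r.
Qed.

Let z1 : `|z.1| <= l. Proof.
move: (h0) (l0) (g0) (M0) (X0) (X1) (Y0) (Y1) (sh) (th) => h0' l0' g0' M0' X0' X1' Y0' Y1' /andP[? ?] /andP[? ?].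
by rewrite /z/= ler_norml; lra.
Qed.

Let z2 : `|z.2| <= l. Proof.
move: (h0) (l0) (g0) (M0) (X0) (X1) (Y0) (Y1) (sh) (th) => h0' l0' g0' M0' X0' X1' Y0' Y1' /andP[? ?] /andP[? ?].
by rewrite /z/= ler_norml; lra.
Qed.

Let corners (P : R * R -> Prop) :
  (forall y, `|y.1| <= l -> `|y.2| <= l -> `|y.1 - z.1| <= h -> `|y.2 - z.2| <= h -> P y) ->
  [/\ P (X, Y), P (X + h, Y), P (X, Y + h) & P (X + h, Y + h)].
Proof.
move: (h0) (l0) (g0) (M0) (X0) (X1) (Y0) (Y1) (sh) (th) => h0' l0' g0' M0' X0' X1' Y0' Y1' /andP[? ?] /andP[? ?].
by move=> H; split; apply: H; rewrite /z/= ler_norml; lra.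
Qed.

Let bil_le (f : R * R -> R) B :
  (forall y, `|y.1| <= l -> `|y.2| <= l -> `|y.1 - z.1| <= h -> `|y.2 - z.2| <= h ->
     `|f y| <= B) -> `|bil f| <= B.
Proof. by move=> /(corners (fun y => `|f y| <= B))[? ? ? ?]; exact: bil4_le. Qed.

(** Interpolation is done along the two horizontal edges and then along the vertical segment through
    [z]. The two edge errors enter with weights [1 - t] and [t], hence the total [M + M]. *)
Let interp_g : `|bil g - g z| <= 2 * M * h ^+ 2.
Proof.
move: (h0) (l0) (g0) (M0) (X0) (X1) (Y0) (Y1) (sh) (th) => h0' l0' g0' M0' X0' X1' Y0' Y1' /andP[? ?] /andP[? ?].
have itp (b : bool) c a (u : R) : `|c| <= l -> - l <= a -> a + h <= l -> 0 <= u <= 1 ->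
    `|(1 - u) * g (slice R b c a) + u * g (slice R b c (a + h))
       - g (slice R b c (a + u * h))| <= M * h ^+ 2.
  move=> hc a1 a2 hu.
  have ah : a <= a + h by rewrite lerDl ltW.
  have := tame_interp _ _ _ _ tg b c a (a + h) u hc a1 ah a2 hu.
  have -> : (1 - u) * a + u * (a + h) = a + u * h by ring.
  by have -> : a + h - a = h by ring.
have Yl : `|Y| <= l by rewrite ler_norml; lra.
have Yhl : `|Y + h| <= l by rewrite ler_norml; lra.
have i1 := itp false Y X s Yl X0 X1 s01.
have i2 := itp false (Y + h) X s Yhl X0 X1 s01.
have i3 := itp true z.1 Y t z1 Y0 Y1 t01.
pose e1 := (1 - s) * g (X, Y) + s * g (X + h, Y) - g (X + s * h, Y).
pose e2 := (1 - s) * g (X, Y + h) + s * g (X + h, Y + h) - g (X + s * h, Y + h).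
pose e3 := (1 - t) * g (X + s * h, Y) + t * g (X + s * h, Y + h)
  - g (X + s * h, Y + t * h).
move: i1 i2 i3; rewrite /slice /z/= -/e1 -/e2 -/e3 => i1 i2 i3.
have -> : bil g - g (X + s * h, Y + t * h) = (1 - t) * e1 + t * e2 + e3.
  by rewrite /bil /bil4 /e1 /e2 /e3; ring.
have /andP[t0 t1] := t01.
rewrite (le_trans (ler_normD _ _))// (_ : 2 * M * h ^+ 2 = M * h ^+ 2 + M * h ^+ 2); last by ring.
rewrite lerD// (le_trans (ler_normD _ _))// !normrM (ger0_norm t0).
rewrite (ger0_norm (_ : 0 <= 1 - t)); [nra|lra].
Qed.

Let r_lip y : `|y.1 - z.1| <= h -> `|y.2 - z.2| <= h -> `|r y - r z| <= 2 * h.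
Proof. by move=> h1 h2; apply: le_trans (dist_lipschitz x y z) _; lra. Qed.

(** The interpolation error of the distance alone is not O(h^2) uniformly near [x]; multiplied by
    [r z] it is. The constant is [(2 + 4) / 2]. *)
Let interp_r : `|r z * bil (fun y => r y - r z)| <= 3 * h ^+ 2.
Proof.
have h1 : `|bil (fun y => (r y - r z) ^+ 2)| <= 4 * h ^+ 2.
  apply: bil_le => y _ _ y1 y2; have := r_lip y y1 y2.
  by rewrite normrX => h1; have := normr_ge0 (r y - r z); nra.
have e2 : bil (fun y => r y ^+ 2) - r z ^+ 2 = (s * (1 - s) + t * (1 - t)) * h ^+ 2.
  by rewrite /bil /r !dist_sqr /bil4 /z/=; ring.
(* r z (r y - r z) = ((r y)^2 - (r z)^2 - (r y - r z)^2) / 2, and the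
   interpolation error of the quadratic (r y)^2 is explicit *)
have -> : r z * bil (fun y => r y - r z) =
    ((bil (fun y => r y ^+ 2) - r z ^+ 2) - bil (fun y => (r y - r z) ^+ 2)) / 2.
  by rewrite /bil /bil4; field.
rewrite e2; move: h1; rewrite !ler_norml.
have : 0 <= (s * (1 - s) + t * (1 - t)) <= 2.
  by case/andP: s01 => ? ?; case/andP: t01 => ? ?; nra.
set u := _ + _ => u2; have : 0 <= h ^+ 2 by rewrite sqr_ge0.
nra.
Qed.

(** Taylor expansion of the exponential at [gamma * r z]: the remainder [T] is quadratic in
    [r y - r z], which is at most [2 * h], and the linear term is left to [interp_r]. *)
Let interp_E : `|r z * (bil E - E z)| <= (4 * gamma ^+ 2 * r z + 3 * gamma) * h ^+ 2.
Proof.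
move: (h0) (l0) (g0) (M0) (X0) (X1) (Y0) (Y1) (sh) (th) => h0' l0' g0' M0' X0' X1' Y0' Y1' /andP[? ?] /andP[? ?].
have r0 y : 0 <= r y by exact: dist_ge0.
have E1 : 0 <= E z <= 1 by rewrite expR_ge0 expR_le1 oppr_le0 mulr_ge0.
pose T y := E y - E z + E z * (gamma * r y - gamma * r z).
have hT : `|bil T| <= 4 * gamma ^+ 2 * h ^+ 2.
  apply: bil_le => y _ _ y1 y2.
  apply: le_trans (expRN_taylor (gamma * r y) (gamma * r z) _ _) _; rewrite ?mulr_ge0//.
  rewrite -mulrBr exprMn -(real_normK (num_real (r y - r z))).
  rewrite -[leRHS](_ : gamma ^+ 2 * (2 * h) ^+ 2 = _); last by ring.
  rewrite ler_wpM2l ?sqr_ge0// lerXn2r ?nnegrE ?r_lip//.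
  by rewrite mulr_ge0// ltW.
have -> : r z * (bil E - E z) =
   r z * bil T - E z * gamma * (r z * bil (fun y => r y - r z)).
  by rewrite /bil /T /bil4; ring.
rewrite (le_trans (ler_normB _ _))// mulrDl lerD//.
  by rewrite normrM (ger0_norm (r0 z)); have := r0 z; nra.
rewrite normrM (ger0_norm (_ : 0 <= E z * gamma)); last first.
  by rewrite mulr_ge0//; lra.
have := interp_r; have := normr_ge0 (r z * bil (fun y => r y - r z)).
move: `|_| => u u0 u3; have [e0 e1] := andP E1.
apply: (@le_trans _ _ (gamma * u)).
  by rewrite ler_wpM2r// -[leRHS]mul1r ler_wpM2r.
by rewrite (_ : 3 * gamma * h ^+ 2 = gamma * (3 * h ^+ 2)); [rewrite ler_wpM2l|ring].
Qed.

Lemma bilinear_product_error :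
  `|bil (fun y => (g y - g x) * E y) - (g z - g x) * E z| <=
    (4 * M * gamma + 2 * M * (16 * gamma ^+ 2 * l + 3 * gamma) + 2 * M) * h ^+ 2.
Proof.
move: (h0) (l0) (g0) (M0) (X0) (X1) (Y0) (Y1) (sh) (th) => h0' l0' g0' M0' X0' X1' Y0' Y1' /andP[? ?] /andP[? ?].
have r0 y : 0 <= r y by exact: dist_ge0.
have E0 y : 0 <= gamma * r y by rewrite mulr_ge0.
have E1 : 0 <= E z <= 1 by rewrite expR_ge0 expR_le1 oppr_le0 E0.
(* discrete Leibniz rule: the factor r z hidden in g z - g x absorbs the 1 / r
   singularity of the second derivatives of exp (- gamma r) *)
have -> : bil (fun y => (g y - g x) * E y) - (g z - g x) * E z =
   bil (fun y => (g y - g z) * (E y - E z)) + (g z - g x) * (bil E - E z) +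
   E z * (bil g - g z) by rewrite /bil /bil4; ring.
rewrite (le_trans (ler_normD _ _))// [leRHS]mulrDl lerD//; last first.
  rewrite normrM ger0_norm; last by lra.
  have := interp_g; have := normr_ge0 (bil g - g z); nra.
rewrite (le_trans (ler_normD _ _))// [leRHS]mulrDl lerD//.
  apply: bil_le => y y1 y2 d1 d2; rewrite normrM.
  have a1 : `|g y - g z| <= 2 * M * h.
    apply: le_trans (tame_lipschitz2 y z y1 y2 z1 z2) _.
    by rewrite (_ : 2 * M * h = M * (h + h)); [rewrite ler_wpM2l// lerD|ring].
  have a2 : `|E y - E z| <= 2 * gamma * h.
    apply: le_trans (expRN_lipschitz _ _ (E0 y) (E0 z)) _.
    by rewrite -mulrBr normrM (ger0_norm g0); have := r_lip y d1 d2; nra.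
  have := normr_ge0 (g y - g z); have := normr_ge0 (E y - E z); nra.
(* Both points lie in the closed square; this turns [4 * gamma ^+ 2 * r z] into the
   [16 * gamma ^+ 2 * l] of the constant. *)
have rz : r z <= 4 * l.
  apply: le_trans (dist_le_dmax _ x z) _; rewrite /dmax.
  suff : Num.max `|x.1 - z.1| `|x.2 - z.2| <= 2 * l by lra.
  move: (x1) (x2) (z1) (z2) => ? ? ? ?.
  by rewrite ge_max !(le_trans (ler_normB _ _))//; lra.
(* The increment of [g] is traded for the factor [r z] that [interp_E] requires. *)
have gz : `|g z - g x| <= 2 * M * r z.
  apply: le_trans (tame_lipschitz2 z x z1 z2 x1 x2) _.
  have : `|z.1 - x.1| <= r z.
    by apply: le_trans (dmax_le_dist _ x z); rewrite /dmax le_max distrC lexx.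
  have : `|z.2 - x.2| <= r z.
    by apply: le_trans (dmax_le_dist _ x z); rewrite /dmax le_max (distrC x.2) lexx orbT.
  nra.
rewrite normrM.
apply: (@le_trans _ _ (2 * M * `|r z * (bil E - E z)|)).
  by rewrite normrM (ger0_norm (r0 z)) mulrA ler_wpM2r.
rewrite -[leRHS]mulrA ler_wpM2l ?mulr_ge0//.
apply: le_trans interp_E _; rewrite ler_wpM2r ?sqr_ge0//.
have := sqr_ge0 gamma; nra.
Qed.

End Cell.
End BilinearError.

(** * The principal value *)

Section PrincipalValue.
Variables (R : realType) (beta gamma : R).
Implicit Types (x y z : plane R) (D : set (plane R)).

(** The tempered kernel. Its value at [y = x] is 0, because 0 to a nonzero power is 0. *)
Definition weight x y : R :=
  expR (- (gamma * eucl_dist x y)) * eucl_dist x y `^ (- (2 + beta)).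

Lemma measurable_weight x : measurable_fun setT (weight x).
Proof.
apply: measurable_funM; last exact: measurable_dist_powR.
apply: measurableT_comp => //; apply: measurableT_comp => //.
by apply: measurable_funM => //; exact: measurable_dist.
Qed.

Lemma weight_ge0 x y : 0 <= weight x y.
Proof. by rewrite mulr_ge0 ?expR_ge0 ?powR_ge0. Qed.

Lemma weight_reflect b1 b2 x y : weight x (reflect_plane R b1 b2 x y) = weight x y.
Proof. by rewrite /weight dist_reflect. Qed.

Lemma weightE x y (a : R) :
  a / (expR (gamma * eucl_dist x y) * eucl_dist x y `^ (2 + beta)) = a * weight x y.
Proof. by rewrite /weight invfM expRN powRN. Qed.

Hypotheses (beta0 : 0 < beta) (beta2 : beta < 2) (gamma0 : 0 <= gamma).

Lemma weight_le x y : weight x y <= eucl_dist x y `^ (- (2 + beta)).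
Proof.
rewrite /weight -[leRHS]mul1r ler_wpM2r ?powR_ge0// expR_le1 oppr_le0.
by rewrite mulr_ge0// dist_ge0.
Qed.

Variables (Cf Cn : R).
Hypothesis far : forall x (r : R), 0 < r ->
  (\int[mu2 R]_(y in ~` box R x r) (eucl_dist x y `^ (- (2 + beta)))%:E
     <= (Cf * r `^ (- beta))%:E)%E.
Hypothesis near : forall x (r : R), 0 < r ->
  (\int[mu2 R]_(y in box R x r) (eucl_dist x y `^ (- beta))%:E
     <= (Cn * r `^ (2 - beta))%:E)%E.

Lemma subset_integral_le D D' (v : plane R -> R) (B : \bar R) :
  measurable D -> measurable D' -> measurable_fun setT v -> (forall y, 0 <= v y) ->
  D `<=` D' -> (\int[mu2 R]_(y in D') (v y)%:E <= B)%E ->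
  (\int[mu2 R]_(y in D) (v y)%:E <= B)%E.
Proof.
move=> mD mD' mv v0 DD'; apply: le_trans; apply: ge0_subset_integral => //.
  exact/measurable_EFinP/measurable_funTS.
by move=> y _; rewrite lee_fin.
Qed.

(** The two regimes: away from [x] the boundedness of [g] is enough against the kernel, whereas up
    to [x] the integrand must gain two powers of the distance, as it does after symmetrisation. *)
Lemma far_dominated x D (f : plane R -> R) (B r : R) : 0 < r -> 0 <= B ->
  measurable D -> D `<=` ~` box R x r -> measurable_fun setT f ->
  (forall y, D y -> `|f y| <= B * eucl_dist x y `^ (- (2 + beta))) ->
  (mu2 R).-integrable D (EFin \o f) /\ `|int2 D f| <= B * (Cf * r `^ (- beta)).
Proof.
move=> r0 B0 mD Dr mf fB.
apply: (Rintegral_dominated R D f (fun y => eucl_dist x y `^ (- (2 + beta)))) => //.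
- exact: measurable_dist_powR.
- by move=> y _; exact: powR_ge0.
apply: subset_integral_le (far x r r0) => //.
- by apply: measurableC; exact: measurable_box.
- exact: measurable_dist_powR.
- by move=> y; exact: powR_ge0.
Qed.

Lemma near_dominated x D (f : plane R -> R) (B r : R) : 0 < r -> 0 <= B ->
  measurable D -> D `<=` box R x r -> measurable_fun setT f ->
  (forall y, D y -> `|f y| <= B * eucl_dist x y `^ (- beta)) ->
  (mu2 R).-integrable D (EFin \o f) /\ `|int2 D f| <= B * (Cn * r `^ (2 - beta)).
Proof.
move=> r0 B0 mD Dr mf fB.
apply: (Rintegral_dominated R D f (fun y => eucl_dist x y `^ (- beta))) => //.
- exact: measurable_dist_powR.
- by move=> y _; exact: powR_ge0.
apply: subset_integral_le (near x r r0) => //.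
- exact: measurable_box.
- exact: measurable_dist_powR.
- by move=> y; exact: powR_ge0.
Qed.

Lemma measurable_beyond x (e : R) : measurable ([set y | e < eucl_dist x y] : set (plane R)).
Proof.
have := measurable_dist R x measurableT [set` `]e, +oo[] (measurable_itv _).
rewrite setTI; congr measurable; apply/seteqP; split => y /=; rewrite in_itv/= ?andbT//.
Qed.

Variables (g : plane R -> R) (x : plane R) (h M M2 : R).
Hypotheses (h0 : 0 < h) (M0 : 0 <= M) (M20 : 0 <= M2).
Hypotheses (mg : measurable_fun setT g) (gM : forall y, `|g y| <= M).
Let rho b1 b2 := reflect_plane R b1 b2 x.
Hypothesis second_diff : forall y, box R x h y ->
  `|g (rho true true y) + g (rho true false y) + g (rho false true y)
     + g (rho false false y) - 4 * g x| <= M2 * eucl_dist x y ^+ 2.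

Let F y := (g x - g y) * weight x y.
(** The average of [F] over the four reflections. It has the same integral as [F] over any invariant
    set away from [x], but is integrable up to [x]. *)
Let S y := (4 * g x - (g (rho true true y) + g (rho true false y)
  + g (rho false true y) + g (rho false false y))) / 4 * weight x y.

Let mF : measurable_fun setT F.
Proof. by apply: measurable_funM; [exact: measurable_funB|exact: measurable_weight]. Qed.

Let mgr b1 b2 : measurable_fun setT (fun y => g (rho b1 b2 y)).
Proof. by apply: measurableT_comp => //; exact: measurable_reflect. Qed.

Let mS : measurable_fun setT S.
Proof.
apply: measurable_funM; last exact: measurable_weight.
apply: measurable_funM => //; apply: measurable_funB => //.
by do 3 (apply: measurable_funD => //).
Qed.

Let F_le y : `|F y| <= 2 * M * eucl_dist x y `^ (- (2 + beta)).
Proof.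
rewrite normrM (ger0_norm (weight_ge0 x y)) ler_pM ?weight_ge0 ?weight_le//.
by rewrite (le_trans (ler_normB _ _))// (_ : 2 * M = M + M) ?lerD//; ring.
Qed.

Let S_le y : box R x h y -> `|S y| <= M2 / 4 * eucl_dist x y `^ (- beta).
Proof.
move=> yh; rewrite normrM (ger0_norm (weight_ge0 x y)) normrM distrC.
rewrite (ger0_norm (_ : 0 <= 4^-1)) ?invr_ge0//.
apply: (@le_trans _ _ (M2 * eucl_dist x y ^+ 2 / 4 * eucl_dist x y `^ (- (2 + beta)))).
  rewrite ler_pM ?weight_ge0 ?weight_le ?mulr_ge0 ?invr_ge0//.
  by rewrite ler_wpM2r ?invr_ge0// second_diff.
rewrite (_ : M2 * _ / 4 * _ = M2 / 4 * (eucl_dist x y ^+ 2 * eucl_dist x y `^ (- (2 + beta))));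
  last by ring.
rewrite ler_wpM2l ?divr_ge0//.
(* The law for adding exponents fails at base 0, where the left side is 0. *)
have [->|d0] := eqVneq (eucl_dist x y) 0; first by rewrite expr0n mul0r powR_ge0.
by rewrite -powR_mulrn ?dist_ge0// -powRD ?d0 ?implybT// opprD addNKr.
Qed.

Let integrable_F D e : 0 < e -> measurable D -> D `<=` ~` box R x e ->
  (mu2 R).-integrable D (EFin \o F).
Proof.
move=> e0 mD De; have h1 : 0 <= 2 * M by rewrite mulr_ge0.
exact: (far_dominated x D F (2 * M) e e0 h1 mD De mF (fun y _ => F_le y)).1.
Qed.

Let integrable_S D : measurable D -> D `<=` box R x h ->
  (mu2 R).-integrable D (EFin \o S).
Proof.
move=> mD Dh; have h1 : 0 <= M2 / 4 by rewrite divr_ge0.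
exact: (near_dominated x D S (M2 / 4) h h0 h1 mD Dh mS (fun y Dy => S_le y (Dh y Dy))).1.
Qed.

(** [F] itself is in general not integrable up to [x], so the four reflected integrals can be added
    only on a set that avoids a box around [x]. *)
Let int2_symmetrize D e : 0 < e -> measurable D -> D `<=` box R x h ->
  D `<=` ~` box R x e -> (forall b1 b2, rho b1 b2 @^-1` D = D) ->
  int2 D F = int2 D S.
Proof.
move=> e0 mD Dh De rD.
have Fr b1 b2 y : (F \o rho b1 b2) y = (g x - g (rho b1 b2 y)) * weight x y.
  by rewrite /F/= /rho weight_reflect.
have iF b1 b2 : (mu2 R).-integrable D (EFin \o (F \o rho b1 b2)).
  apply: (far_dominated x D (F \o rho b1 b2) (2 * M) e e0 _ mD De _ _).1.
  - by rewrite mulr_ge0.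
  - by apply: measurableT_comp => //; exact: measurable_reflect.
  - by move=> y _; apply: le_trans (F_le _) _; rewrite /rho dist_reflect.
have eF b1 b2 : int2 D (F \o rho b1 b2) = int2 D F.
  exact: (int2_reflect R b1 b2 x D F mD mF (rD b1 b2) (iF b1 b2)).
have i2 b : (mu2 R).-integrable D
    (EFin \o (fun y => (F \o rho b true) y + (F \o rho b false) y)).
  exact: (integrableD mD (iF b true) (iF b false)).
have e2 b : int2 D (fun y => (F \o rho b true) y + (F \o rho b false) y)
    = int2 D F + int2 D F.
  by rewrite -{1}(eF b true) -(eF b false); exact: RintegralD.
have i4 : (mu2 R).-integrable D (EFin \o (fun y =>
    ((F \o rho true true) y + (F \o rho true false) y)
    + ((F \o rho false true) y + (F \o rho false false) y))).
  exact: (integrableD mD (i2 true) (i2 false)).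
have e4 : int2 D (fun y => ((F \o rho true true) y + (F \o rho true false) y)
    + ((F \o rho false true) y + (F \o rho false false) y))
    = (int2 D F + int2 D F) + (int2 D F + int2 D F).
  by rewrite -{1}(e2 true) -(e2 false); exact: RintegralD.
have -> : int2 D S = 4^-1 * int2 D (fun y =>
    ((F \o rho true true) y + (F \o rho true false) y)
    + ((F \o rho false true) y + (F \o rho false false) y)).
  rewrite -[RHS](RintegralZl _ mD i4).
  by apply: eq_Rintegral => y _; rewrite !Fr /S; field.
by rewrite e4; field.
Qed.

Let Q := box R x h.
(** The value of the principal value: both integrals converge absolutely. *)
Let L := int2 (~` Q) F + int2 Q S.
Let mQ : measurable Q. Proof. exact: measurable_box. Qed.

Let beyond_sub e : 0 < e -> [set y | e < eucl_dist x y] `<=` ~` box R x (e / 2).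
Proof.
move=> e0 y /=; rewrite /box/= => ey ye; have := dist_le_dmax R x y; lra.
Qed.

(** The truncated integral misses only the integral of [S] over the disc of radius [e], and this
    disc lies in the box of radius [e]. *)
Let pv_error e : 0 < e -> e < h ->
  `|int2 [set y | e < eucl_dist x y] F - L| <= M2 / 4 * (Cn * e `^ (2 - beta)).
Proof.
move=> e0 eh; set De := [set y | e < eucl_dist x y].
have mDe : measurable (De : set (plane R)) by exact: measurable_beyond.
have e20 : 0 < e / 2 by rewrite divr_gt0.
have subDe : De `<=` ~` box R x (e / 2) by exact: beyond_sub.
have QDe : De = ~` Q `|` (Q `&` De).
  apply/seteqP; split => y.
    by move=> ey; have [Qy|Qy] := pselect (Q y); [right|left].
  move=> [|[]//]; rewrite /De /Q /box/= => /negP; rewrite -ltNge => hy.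
  exact: lt_le_trans (lt_trans eh hy) (dmax_le_dist _ _ _).
have mQD : measurable (Q `&` De) by exact: measurableI.
have mCQ : measurable (~` Q) by exact: measurableC.
have s1 : int2 De F = int2 (~` Q) F + int2 (Q `&` De) F.
  rewrite {1}QDe; apply: Rintegral_setU => //.
    by rewrite -QDe; exact: integrable_F subDe.
  by apply/disj_setPS => y [Qy [/Qy]].
have s2 : int2 (Q `&` De) F = int2 (Q `&` De) S.
  apply: (int2_symmetrize _ (e / 2)) => //.
  - by move=> y [_ /subDe].
  - move=> b1 b2; apply/seteqP; split => y.
      by move=> [] ; rewrite /Q /De /= box_reflect /rho dist_reflect.
    by move=> [Qy Dy]; split; rewrite /Q /De /= ?box_reflect /rho ?dist_reflect.
have s3 : int2 Q S = int2 (Q `&` De) S + int2 (Q `&` ~` De) S.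
  have {1}-> : Q = (Q `&` De) `|` (Q `&` ~` De) by rewrite -setIUr setUv setIT.
  apply: Rintegral_setU => //.
  - by apply: measurableI => //; exact: measurableC.
  - by rewrite -setIUr setUv setIT; exact: integrable_S.
  - by apply/disj_setPS => y [[_ Dy] [_ /(_ Dy)]].
have -> : int2 De F - L = - int2 (Q `&` ~` De) S by rewrite s1 s2 /L s3; ring.
rewrite normrN; apply: (near_dominated x _ _ _ e e0 _ _ _ mS _).2.
- by rewrite divr_ge0.
- by apply: measurableI => //; exact: measurableC.
- move=> y [_ /negP]; rewrite /De /box/= -leNgt; apply: le_trans.
  exact: dmax_le_dist.
- by move=> y [Qy _]; exact: S_le.
Qed.

Lemma principal_value_limit :
  exists2 P, int2 [set y | e < eucl_dist x y] F @[e --> (0 : R)^'+] --> P &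
    `|P - int2 (~` Q) F| <= M2 / 4 * (Cn * h `^ (2 - beta)).
Proof.
exists L; last first.
  rewrite /L addrAC subrr add0r; apply: (near_dominated x Q S _ h h0 _ mQ _ mS _).2 => //.
  by rewrite divr_ge0.
apply/cvgrPdist_le => eps eps0.
have p0 : 0 < 2 - beta by move: beta2; lra.
have c0 : M2 / 4 * (Cn * e `^ (2 - beta)) @[e --> (0 : R)^'+] --> (0 : R).
  have c1 : M2 / 4 * (Cn * e `^ (2 - beta)) @[e --> (0 : R)^'+] --> M2 / 4 * (Cn * 0).
    apply: cvgM; first exact: cvg_cst.
    by apply: cvgM; [exact: cvg_cst|exact: powR_cvg0].
  by rewrite !mulr0 in c1.
near=> e.
have e0 : 0 < e by near: e; exact: nbhs_right_gt.
have eh : e < h by near: e; exact: nbhs_right_lt.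
rewrite distrC; apply: le_trans (pv_error e e0 eh) _.
apply: le_trans (ler_norm _) _; rewrite -normrN -[X in `|X|]add0r.
by near: e; apply: cvgr_dist_le.
Unshelve. all: by end_near. Qed.

End PrincipalValue.

(** * Real-valued error estimate *)

Lemma powRD_gt0 (R : realType) (t a b : R) : 0 < t -> t `^ (a + b) = t `^ a * t `^ b.
Proof. by move=> t0; rewrite powRD//; apply/implyP => _; rewrite gt_eqF. Qed.

Lemma ler_norm_add3 (R : realDomainType) (a b c B : R) :
  `|a| <= B -> `|b| <= B -> `|c| <= B -> `|a + b + c| <= 3 * B.
Proof.
move=> ha hb hc; rewrite (le_trans (ler_normD _ _))//.
by have := ler_normD a b; lra.
Qed.

Lemma grid_index_bound (N : nat) (a : 'I_N.*2) :
  - N%:Z <= (a : nat)%:Z - N%:Z < N%:Z.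
Proof. by have := ltn_ord a; lia. Qed.

Lemma measurable_bil4 (R : realType) (s t : plane R -> R) (a b c d : R) :
  measurable_fun setT s -> measurable_fun setT t ->
  measurable_fun setT (fun z => bil4 R (s z) (t z) a b c d).
Proof.
move=> ms mt; have ms1 : measurable_fun setT (fun z => 1 - s z) by exact: measurable_funB.
have mt1 : measurable_fun setT (fun z => 1 - t z) by exact: measurable_funB.
have mp (f k : plane R -> R) (e : R) : measurable_fun setT f -> measurable_fun setT k ->
    measurable_fun setT (fun z => f z * k z * e).
  by move=> mf mk; apply: measurable_funM => //; exact: measurable_funM.
rewrite /bil4; apply: measurable_funD; last exact: mp.
by apply: measurable_funD; [apply: measurable_funD|]; exact: mp.
Qed.

Section RealEstimate.
Variables (R : realType) (beta gamma sigma l M : R) (g : R * R -> R).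
Hypotheses (beta0 : 0 < beta) (beta2 : beta < 2) (gamma0 : 0 <= gamma).
Hypotheses (bs : beta < sigma) (sigma2 : sigma <= 2) (l0 : 0 < l) (tg : tame R l M g).

Let M0 : 0 <= M. Proof. exact: tame_ge0 tg. Qed.

(** This is the interpolation bound at [s = 1/2], doubled. The segment has length [2 |m - a|], hence
    [2 * 4 = 8]. *)
Lemma midpoint_diff (b : bool) (c a m : R) : `|c| <= l -> `|a| <= l -> `|2 * m - a| <= l ->
  `|g (slice R b c (2 * m - a)) + g (slice R b c a) - 2 * g (slice R b c m)|
    <= 8 * M * (m - a) ^+ 2.
Proof.
have main u v : `|c| <= l -> - l <= u -> u <= v -> v <= l ->
    `|g (slice R b c u) + g (slice R b c v) - 2 * g (slice R b c ((u + v) / 2))|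
      <= 2 * M * (v - u) ^+ 2.
  move=> hc u1 uv v1; have h2 : 0 <= (2^-1 : R) <= 1 by lra.
  have := tame_interp _ _ _ _ tg b c u v 2^-1 hc u1 uv v1 h2.
  have -> : (1 - 2^-1) * u + 2^-1 * v = (u + v) / 2 by field.
  set w := g _ + _ - _; rewrite [X in `|X| <= _ -> _](_ : _ = w / 2); last by rewrite /w; field.
  by rewrite normrM (ger0_norm (_ : 0 <= 2^-1)) ?invr_ge0//; lra.
move=> hc /ler_normlP[a1 a2] /ler_normlP[a3 a4].
have em : (a + (2 * m - a)) / 2 = m by field.
have [am|/ltW am] := leP a (2 * m - a).
  have := main a (2 * m - a) hc ltac:(lra) am a4; rewrite em.
  rewrite (addrC (g (slice R b c a))) (_ : 2 * M * _ = 8 * M * (m - a) ^+ 2)//; ring.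
have := main (2 * m - a) a hc ltac:(lra) am a2; rewrite (addrC (2 * m - a) a) em.
by rewrite (_ : 2 * M * _ = 8 * M * (m - a) ^+ 2)//; ring.
Qed.

(** The four values pair into horizontal second differences at the heights [2 * x.2 - y.2] and
    [y.2]. Their midpoints lie on the vertical line through [x] and form one vertical second
    difference, counted twice; so no mixed derivative enters. *)
Lemma second_difference_le (x y : R * R) : `|y.1| <= l -> `|y.2| <= l ->
  `|2 * x.1 - y.1| <= l -> `|2 * x.2 - y.2| <= l ->
  let rho b1 b2 := reflect_plane R b1 b2 x in
  `|g (rho true true y) + g (rho true false y) + g (rho false true y)
     + g (rho false false y) - 4 * g x| <= 16 * M * eucl_dist x y ^+ 2.
Proof.
move=> y1 y2 r1 r2 /=.
have x1 : `|x.1| <= l by move: y1 r1; rewrite !ler_norml; lra.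
have d1 := midpoint_diff false _ _ _ r2 y1 r1.
have d2 := midpoint_diff false _ _ _ y2 y1 r1.
have d3 := midpoint_diff true _ _ _ x1 y2 r2.
move: d1 d2 d3; rewrite /reflect_plane /flip /slice/= dist_sqr.
case: x y {y1 y2 r1 r2 x1} => [x1 x2] [y1 y2]/=.
rewrite !ler_norml => /andP[? ?] /andP[? ?] /andP[? ?].
by apply/andP; split; lra.
Qed.

Section Mesh.
Variables (N : nat) (p q : int).
Hypotheses (N0 : (0 < N)%N) (hp : - N%:Z < p < N%:Z) (hq : - N%:Z < q < N%:Z).
Let h := mesh l N.
Let x : R * R := Defs.point l N p q.
Let h0 : 0 < h. Proof. exact: mesh_gt0. Qed.

Lemma node_bound (k : int) : - N%:Z < k < N%:Z -> `|k%:~R * h| + h <= l.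
Proof.
move=> kN; have := meshN R l N N0; rewrite -/h => <-.
have h0' := ltW h0.
rewrite normrM (ger0_norm h0') -[X in _ + X]mul1r -mulrDl ler_wpM2r//.
by rewrite -intr_norm -[X in _ + X](_ : 1%:~R = 1)// -intrD pmulrn ler_int; lia.
Qed.

Let x1h : `|x.1| + h <= l. Proof. exact: node_bound. Qed.
Let x2h : `|x.2| + h <= l. Proof. exact: node_bound. Qed.

Lemma box_node_second_diff (y : R * R) : box R x h y ->
  let rho b1 b2 := reflect_plane R b1 b2 x in
  `|g (rho true true y) + g (rho true false y) + g (rho false true y)
     + g (rho false false y) - 4 * g x| <= 16 * M * eucl_dist x y ^+ 2.
Proof.
rewrite /box/= /dmax ge_max => /andP[y1 y2].
move: (x1h) (x2h) => b1 b2.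
have B (a b : R) : `|a| + h <= l -> `|a - b| <= h -> `|b| <= l /\ `|2 * a - b| <= l.
  move=> al ab; have eb : b = a - (a - b) by ring.
  have e2b : 2 * a - b = a + (a - b) by ring.
  rewrite e2b {1}eb.
  by split; [apply: le_trans (ler_normB _ _) _|apply: le_trans (ler_normD _ _) _]; lra.
have [? ?] := B _ _ b1 y1; have [? ?] := B _ _ b2 y2.
exact: second_difference_le.
Qed.

Lemma dist_node (i j : int) :
  eucl_dist x (Defs.point l N i j) = idist l N (i - p) (j - q).
Proof.
rewrite /eucl_dist /x /idist /Defs.point/= -/h.
rewrite -[X in X * Num.sqrt _](ger0_norm (ltW h0)) -sqrtr_sqr -sqrtrM ?sqr_ge0//.
by congr Num.sqrt; rewrite !intrB; ring.
Qed.

(** The scheme is linear in [u] with real coefficients, so it acts on real and imaginary parts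
    separately. These are its ingredients for one part. *)
Definition phiR (u : int -> int -> R) (a b : int) : R :=
  (u (p + a) (q + b) + u (p - a) (q + b) + u (p - a) (q - b) +
   u (p + a) (q - b) - 4 * u p q) /
  (expR (gamma * idist l N a b) * idist l N a b `^ sigma).

Definition bilinR (w : int -> int -> R) (i j : int) (z : R * R) : R :=
  bil4 R ((z.1 - i%:~R * h) / h) ((z.2 - j%:~R * h) / h)
    (w i j) (w (i + 1) j) (w i (j + 1)) (w (i + 1) (j + 1)).

Definition cellR (u : int -> int -> R) (i j : int) : R :=
  int2 (cell l N i j) (fun z => bilinR (fun i' j' =>
    (u i' j' - u p q) * expR (- (gamma * idist l N (i' - p) (j' - q)))) i j z
    * kernel2 l N beta p q z).

Definition discreteR (u : int -> int -> R) : R :=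
  ksigma sigma / 4 * W00 l N beta sigma * (phiR u 0 1 + phiR u 1 0 + phiR u 1 1) +
   \sum_(a < N.*2) \sum_(b < N.*2 |
       ~~ near_cell p q ((a : nat)%:Z - N%:Z) ((b : nat)%:Z - N%:Z))
     cellR u ((a : nat)%:Z - N%:Z) ((b : nat)%:Z - N%:Z) -
   Winfty l N beta gamma p q * u p q.

Let u (i j : int) : R := g (Defs.point l N i j).

Lemma kernel2E z : kernel2 l N beta p q z = eucl_dist x z `^ (- (2 + beta)).
Proof.
rewrite /kernel2 -/x (_ : - (2 + beta) = 2 * - ((2 + beta) / 2)); last by field.
rewrite powRrM powR_mulrn ?dist_ge0// dist_sqr; congr (_ `^ _).
by rewrite -(sqrrN (x.1 - z.1)) -(sqrrN (x.2 - z.2)) !opprB.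
Qed.

(** The numerator is the four-fold second difference at the neighbouring node [y], whose squared
    distance is at most [2 * h ^+ 2]; the denominator is at least [h] to the power [sigma]. *)
Lemma phiR_le (a b : int) : a = 0 \/ a = 1 -> b = 0 \/ b = 1 -> (a, b) != (0, 0) ->
  `|phiR u a b| <= 32 * M * h `^ (2 - sigma).
Proof.
move=> ha hb hab; pose y : R * R := Defs.point l N (p + a) (q + b).
have dy : eucl_dist x y = idist l N a b.
  by rewrite /y dist_node; congr (idist l N _ _); ring.
have h0' := ltW h0.
have idE : idist l N a b = h * Num.sqrt (a%:~R ^+ 2 + b%:~R ^+ 2) by [].
have [ab1 ab2] : (1 : R) <= a%:~R ^+ 2 + b%:~R ^+ 2 /\ a%:~R ^+ 2 + b%:~R ^+ 2 <= (2 : R).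
  by case: ha hb hab => -> [->|->] //= _; rewrite ?mulr0z ?mulr1z ?expr0n ?expr1n/=; split; lra.
have idh : h <= idist l N a b.
  by rewrite idE -[leLHS]mulr1 ler_wpM2l// -[leLHS]sqrtr1 ler_sqrt//; lra.
have id2 : idist l N a b ^+ 2 <= 2 * h ^+ 2.
  rewrite idE exprMn sqr_sqrtr; last by lra.
  by rewrite mulrC ler_wpM2r ?sqr_ge0.
have idp : 0 < idist l N a b by exact: lt_le_trans idh.
have yb : box R x h y.
  have H (k m : int) : m = 0 \/ m = 1 -> `|k%:~R * h - (k + m)%:~R * h| <= h.
    move=> hm; rewrite intrD mulrDl opprD addrA subrr add0r normrN normrM (ger0_norm h0').
    by case: hm => ->; rewrite ?mulr0z ?mulr1z ?normr0 ?normr1 ?mul0r ?mul1r.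
  by rewrite /box/= /dmax ge_max /x /y /Defs.point/= -/h !H.
have := box_node_second_diff y yb; rewrite dy.
have r1 (k m : int) : 2 * (k%:~R * h) - (k + m)%:~R * h = (k - m)%:~R * h :> R.
  by rewrite intrD intrB; ring.
rewrite /x /y /reflect_plane /flip /Defs.point/= -/h !r1 => D.
rewrite /phiR normrM normfV (ger0_norm (_ : 0 <= expR _ * _)); last first.
  by rewrite mulr_ge0 ?expR_ge0 ?powR_ge0.
rewrite ler_pdivrMr; last by rewrite mulr_gt0 ?expR_gt0 ?powR_gt0.
apply: (@le_trans _ _ (16 * M * idist l N a b ^+ 2)).
  apply: le_trans D; rewrite le_eqVlt; apply/orP; left; apply/eqP.
  by rewrite /u /Defs.point/= -/h; congr (`|_|); ring.
apply: (@le_trans _ _ (32 * M * h ^+ 2)).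
  rewrite (_ : 32 * M * _ = 16 * M * (2 * h ^+ 2)); last by ring.
  by rewrite ler_wpM2l// mulr_ge0.
have -> : h ^+ 2 = h `^ (2 - sigma) * h `^ sigma.
  by rewrite -powRD_gt0// subrK powR_mulrn.
rewrite mulrA ler_wpM2l ?mulr_ge0 ?powR_ge0//.
rewrite -[leLHS]mul1r; apply: ler_pM; rewrite ?powR_ge0//.
  by rewrite -expR0 ler_expR mulr_ge0// ltW.
apply: (@ge0_ler_powR _ sigma); rewrite ?nnegrE//; last exact: ltW.
by move: (bs) (beta0); lra.
Qed.

Variables (Cf Cn Cw : R).
Hypothesis far : forall (x : plane R) (r : R), 0 < r ->
  (\int[mu2 R]_(y in ~` box R x r) (eucl_dist x y `^ (- (2 + beta)))%:E
     <= (Cf * r `^ (- beta))%:E)%E.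
Hypothesis near : forall (x : plane R) (r : R), 0 < r ->
  (\int[mu2 R]_(y in box R x r) (eucl_dist x y `^ (- beta))%:E
     <= (Cn * r `^ (2 - beta))%:E)%E.
Hypothesis nearW : forall (x : plane R) (r : R), 0 < r ->
  (\int[mu2 R]_(y in box R x r) (eucl_dist x y `^ (sigma - 2 - beta))%:E
     <= (Cw * r `^ (sigma - beta))%:E)%E.

Lemma W00_le : `|W00 l N beta sigma| <= Cw * h `^ (sigma - beta).
Proof.
have E z : (z.1 ^+ 2 + z.2 ^+ 2) `^ ((sigma - 2 - beta) / 2) =
    eucl_dist (0, 0) z `^ (sigma - 2 - beta).
  rewrite -[in RHS](_ : 2 * ((sigma - 2 - beta) / 2) = sigma - 2 - beta); last by field.
  by rewrite [in RHS]powRrM [in RHS]powR_mulrn ?dist_ge0// dist_sqr/= !sub0r !sqrrN.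
rewrite /W00 -[leRHS]mul1r.
apply: (Rintegral_dominated R (cell l N 0 0) _
  (fun y => eucl_dist (0, 0) y `^ (sigma - 2 - beta)) _ 1 _ _ _ _ _ _ _).2 => //.
- exact: measurable_cell.
- under eq_fun do rewrite E; exact: measurable_dist_powR.
- exact: measurable_dist_powR.
- by move=> y _; exact: powR_ge0.
- by move=> y _; rewrite E mul1r ger0_norm// powR_ge0.
- apply: subset_integral_le (nearW (0, 0) h h0) => //.
  + exact: measurable_cell.
  + exact: measurable_box.
  + exact: measurable_dist_powR.
  + by move=> y; exact: powR_ge0.
  + move=> z; rewrite /cell /box/= /dmax ge_max -/h !mul0r add0r !mul1r.
    by move=> /andP[/andP[? ?] /andP[? ?]]; rewrite !sub0r !normrN !ger0_norm//; lra.
Qed.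

(** For both values of [ksigma] the factor [ksigma / 4] is at most 1/3, which compensates for the
    three quotients. *)
Lemma near_part_le :
  `|ksigma sigma / 4 * W00 l N beta sigma * (phiR u 0 1 + phiR u 1 0 + phiR u 1 1)|
    <= 32 * M * Cw * h `^ (2 - beta).
Proof.
have k3 : 0 <= ksigma sigma / 4 <= 3^-1 by rewrite /ksigma; case: ifP => _; lra.
have p1 := phiR_le 0 1 (or_introl erefl) (or_intror erefl) isT.
have p2 := phiR_le 1 0 (or_intror erefl) (or_introl erefl) isT.
have p3 := phiR_le 1 1 (or_intror erefl) (or_intror erefl) isT.
have hh : h `^ (2 - beta) = h `^ (2 - sigma) * h `^ (sigma - beta).
  by rewrite -powRD_gt0//; congr (_ `^ _); ring.
rewrite hh 2!normrM (ger0_norm (_ : 0 <= ksigma sigma / 4)); last by case/andP: k3.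
have P3 : `|phiR u 0 1 + phiR u 1 0 + phiR u 1 1| <= 3 * (32 * M * h `^ (2 - sigma)).
  exact: (ler_norm_add3 _ _ _ _ _ p1 p2 p3).
rewrite (_ : 32 * M * Cw * _ = (3^-1 * (Cw * h `^ (sigma - beta)))
  * (3 * (32 * M * h `^ (2 - sigma)))); last by field.
apply: ler_pM => //; first by rewrite mulr_ge0//; case/andP: k3.
by apply: ler_pM => //; [case/andP: k3|case/andP: k3|exact: W00_le].
Qed.

Let kap (y : plane R) : R := eucl_dist x y `^ (- (2 + beta)).
Let F (y : plane R) : R := (g x - g y) * weight R beta gamma x y.
Let K : R := 4 * M * gamma + 2 * M * (16 * gamma ^+ 2 * l + 3 * gamma) + 2 * M.

Let K0 : 0 <= K.
Proof. by rewrite /K !addr_ge0 ?mulr_ge0 ?addr_ge0 ?mulr_ge0 ?sqr_ge0 ?(ltW l0). Qed.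

Let mF : measurable_fun setT F.
Proof.
apply: measurable_funM; last exact: measurable_weight.
by apply: measurable_funB => //; exact: (tame_measurable _ _ _ _ tg).
Qed.

Let diff_le (y z : R * R) : `|g y - g z| <= 2 * M.
Proof.
rewrite (le_trans (ler_normB _ _))// (_ : 2 * M = M + M); last by ring.
by apply: lerD; exact: (tame_bound _ _ _ _ tg).
Qed.

Let F_le y : `|F y| <= 2 * M * kap y.
Proof.
rewrite normrM (ger0_norm (weight_ge0 _ _ _ _ _)).
by apply: ler_pM; rewrite ?weight_ge0 ?diff_le ?weight_le.
Qed.

Let integrable_F (D : set (plane R)) : measurable D -> D `<=` ~` box R x (h / 2) ->
  (mu2 R).-integrable D (EFin \o F).
Proof.
move=> mD Dh; have h20 : 0 < h / 2 by rewrite divr_gt0.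
have M20 : 0 <= 2 * M by rewrite mulr_ge0.
exact: (far_dominated R beta Cf far x D F (2 * M) (h / 2) h20 M20 mD Dh mF
  (fun y _ => F_le y)).1.
Qed.

Let integrable_kap (D : set (plane R)) : measurable D -> D `<=` ~` box R x (h / 2) ->
  (mu2 R).-integrable D (EFin \o kap).
Proof.
move=> mD Dh; have h20 : 0 < h / 2 by rewrite divr_gt0.
apply: (far_dominated R beta Cf far x D kap 1 (h / 2) h20 ler01 mD Dh _ _).1.
  exact: measurable_dist_powR.
by move=> y _; rewrite mul1r ger0_norm// powR_ge0.
Qed.

Lemma grid_interval (k : int) : - N%:Z <= k < N%:Z ->
  - l <= k%:~R * h /\ k%:~R * h + h <= l.
Proof.
move=> /andP[k1 k2]; have := meshN R l N N0; rewrite -/h => e.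
have h0' := ltW h0; split.
  by rewrite -e -mulNr ler_wpM2r// pmulrn -intrN ler_int.
by rewrite -[X in _ + X]mul1r -mulrDl -e ler_wpM2r// pmulrn -intrD1 ler_int -ltzD1 ltrD2r.
Qed.

(** [F] contains [g x - g y] while the scheme contains [u i j - u p q], so the sum on the left is an
    interpolation error. The integral of [kap] is kept unevaluated, to be summed over the cells. *)
Lemma cell_error (i j : int) : - N%:Z <= i < N%:Z -> - N%:Z <= j < N%:Z ->
  ~~ near_cell p q i j ->
  `|int2 (cell l N i j) F + cellR u i j| <= K * h ^+ 2 * int2 (cell l N i j) kap.
Proof.
move=> hi hj nij.
have mC : measurable (cell l N i j : set (plane R)) by exact: measurable_cell.
have subC := far_cell_sub R l N l0 N0 p q hp hq i j nij.
have [X0 X1] := grid_interval i hi; have [Y0 Y1] := grid_interval j hj.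
pose w i' j' := (u i' j' - u p q) * expR (- (gamma * idist l N (i' - p) (j' - q))).
pose E (y : R * R) := expR (- (gamma * eucl_dist x y)).
have wE i' j' : w i' j' = (g (Defs.point l N i' j') - g x) * E (Defs.point l N i' j').
  by rewrite /w /E dist_node.
have E1 y : 0 <= E y <= 1.
  by rewrite /E expR_ge0 expR_le1 oppr_le0 mulr_ge0// dist_ge0.
have w_le i' j' : `|w i' j'| <= 2 * M.
  rewrite wE normrM -[leRHS]mulr1; have /andP[e0 e1] := E1 (Defs.point l N i' j').
  by apply: ler_pM => //; rewrite ger0_norm.
have in01 (a b : R) : b * h <= a <= (b + 1) * h -> 0 <= (a - b * h) / h <= 1.
  move=> /andP[ab ba]; rewrite divr_ge0 ?subr_ge0 ?(ltW h0)//= ler_pdivrMr// mul1r.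
  by move: ba; rewrite mulrDl mul1r; lra.
have st01 z : cell l N i j z -> 0 <= (z.1 - i%:~R * h) / h <= 1 /\
    0 <= (z.2 - j%:~R * h) / h <= 1.
  rewrite /cell/= -/h => /andP[z1 z2].
  by split; apply: in01; move: z1 z2; rewrite !intrD.
pose G z := bilinR w i j z * kernel2 l N beta p q z.
have mG : measurable_fun setT (G : plane R -> R).
  apply: measurable_funM; last first.
    have -> : kernel2 l N beta p q = kap by apply/funext => z; rewrite kernel2E.
    exact: measurable_dist_powR.
  have m1 (c : R) : measurable_fun setT (fun z : plane R => (z.1 - c) / h).
    apply: measurable_funM => //; apply: measurable_funB => //.
  have m2 (c : R) : measurable_fun setT (fun z : plane R => (z.2 - c) / h).
    apply: measurable_funM => //; apply: measurable_funB => //.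
  exact: (measurable_bil4 R _ _ _ _ _ _ (m1 _) (m2 _)).
have G_le z : cell l N i j z -> `|G z| <= 2 * M * kap z.
  move=> /st01[s01 t01]; rewrite /G kernel2E normrM (ger0_norm (powR_ge0 _ _)).
  by rewrite ler_wpM2r ?powR_ge0//; exact: bil4_le.
have h20 : 0 < h / 2 by rewrite divr_gt0.
have M20 : 0 <= 2 * M by rewrite mulr_ge0.
have iG := (far_dominated R beta Cf far x _ G (2 * M) (h / 2) h20 M20 mC subC mG G_le).1.
have iF := integrable_F _ mC subC.
have ik := integrable_kap _ mC subC.
have -> : int2 (cell l N i j) F + cellR u i j = int2 (cell l N i j) (fun z => F z + G z).
  by apply: esym; exact: RintegralD.
apply: (Rintegral_dominated R (cell l N i j) (fun z => F z + G z) kap _ _ mC _ _ _ _ _ _).2.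
- exact: measurable_funD.
- exact: measurable_dist_powR.
- by rewrite mulr_ge0 ?sqr_ge0.
- by move=> y _; exact: powR_ge0.
- move=> z cz; have [s01 t01] := st01 z cz.
  rewrite (_ : F z + G z = (bilinR w i j z - (g z - g x) * E z) * kap z); last first.
    by rewrite /F /G /weight kernel2E -/(kap z) -/(E z); ring.
  rewrite normrM (ger0_norm (powR_ge0 _ _)) ler_wpM2r ?powR_ge0//.
  have xl1 : `|x.1| <= l by move: (x1h) (ltW h0) => b1 b2; lra.
  have xl2 : `|x.2| <= l by move: (x2h) (ltW h0) => b1 b2; lra.
  have := bilinear_product_error R l M gamma h g x (i%:~R * h) (j%:~R * h) _ _
    l0 h0 gamma0 tg xl1 xl2 X0 X1 Y0 Y1 s01 t01.
  rewrite !divfK ?gt_eqF// !(addrC _ (_ - _)) !subrK -(surjective_pairing z).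
  congr (`|_ - _| <= _); rewrite /bilinR !wE /E /Defs.point/= -/h.
  by rewrite !intrD !mulrDl !mul1r.
- by rewrite /int2 /Rintegral fineK//; exact: integrable_fin_num.
Qed.

Lemma real_error : exists2 P,
  int2 [set y | e < eucl_dist x y] F @[e --> (0 : R)^'+] --> P &
  `|- P - discreteR u| <= (4 * M * Cn + K * Cf + 32 * M * Cw) * h `^ (2 - beta).
Proof.
have [P cP HP] := principal_value_limit R beta gamma beta2 gamma0 Cf Cn far near g x h
  M (16 * M) h0 M0 (mulr_ge0 (ler0n _ _) M0) (tame_measurable _ _ _ _ tg)
  (tame_bound _ _ _ _ tg) box_node_second_diff.
exists P => //.
have mB r : measurable (~` box R x r) by apply: measurableC; exact: measurable_box.
have iF : (mu2 R).-integrable (~` box R x (h / 2)) (EFin \o F) by exact: integrable_F.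
have ik : (mu2 R).-integrable (~` box R x (h / 2)) (EFin \o kap) by exact: integrable_kap.
have sF := int2_grid_split R l N l0 N0 p q hp hq F iF.
have sk := int2_grid_split R l N l0 N0 p q hp hq kap ik.
have mS : measurable (~` square l : set (plane R)).
  by apply: measurableC; exact: measurable_square.
have subS := outside_sub R l N l0 N0 p q hp hq.
have wE z : expR (- (gamma * eucl_dist z x)) * kernel2 l N beta p q z =
    weight R beta gamma x z.
  rewrite kernel2E /weight /eucl_dist; congr (expR (- (gamma * Num.sqrt _)) * _).
  by rewrite -(sqrrN (z.1 - x.1)) -(sqrrN (z.2 - x.2)) !opprB.
have iw : (mu2 R).-integrable (~` square l) (EFin \o weight R beta gamma x).
  have h20 : 0 < h / 2 by rewrite divr_gt0.
  apply: (far_dominated R beta Cf far x _ _ 1 (h / 2) h20 ler01 mS subS _ _).1.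
    exact: measurable_weight.
  by move=> y _; rewrite mul1r ger0_norm ?weight_ge0//; exact: weight_le.
(* Outside the square [g] vanishes, and [F] is the constant [g x] times the weight: exactly the
   exterior term of the scheme. *)
have sW : int2 (~` square l) F = Winfty l N beta gamma p q * g x.
  rewrite mulrC /Winfty -/x -[RHS](RintegralZl _ mS); last first.
    by under eq_fun do rewrite wE.
  apply: eq_Rintegral => z; rewrite inE => nz.
  by rewrite /F (tame_outside _ _ _ _ tg z nz) subr0 wE.
pose ix (a : 'I_N.*2) : int := (a : nat)%:Z - N%:Z.
have ixN a : - N%:Z <= ix a < N%:Z by exact: grid_index_bound.
have far_sum : `|\sum_(a < N.*2) \sum_(b < N.*2 | ~~ near_cell p q (ix a) (ix b))
     (int2 (cell l N (ix a) (ix b)) F + cellR u (ix a) (ix b))|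
     <= K * Cf * h `^ (2 - beta).
  apply: (@le_trans _ _ (\sum_(a < N.*2)
      \sum_(b < N.*2 | ~~ near_cell p q (ix a) (ix b))
      K * h ^+ 2 * int2 (cell l N (ix a) (ix b)) kap)).
    apply: le_trans (ler_norm_sum _ _ _) _; apply: ler_sum => a _.
    apply: le_trans (ler_norm_sum _ _ _) _; apply: ler_sum => b nab.
    exact: cell_error.
  under eq_bigr do rewrite -mulr_sumr.
  rewrite -mulr_sumr.
  (* Dropping the nonnegative exterior part, the cell integrals of [kap] add up to at most its
     integral off the box, which is O(h^(-beta)) whatever the number of cells. *)
  have S0 : 0 <= int2 (~` square l) kap by apply: Rintegral_ge0 => y _; exact: powR_ge0.
  have Q1 : `|int2 (~` box R x h) kap| <= 1 * (Cf * h `^ (- beta)).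
    apply: (far_dominated R beta Cf far x _ kap 1 h h0 ler01 (mB h) _ _ _).2 => //.
      exact: measurable_dist_powR.
    by move=> y _; rewrite mul1r ger0_norm// powR_ge0.
  rewrite (_ : K * Cf * h `^ (2 - beta) = K * h ^+ 2 * (Cf * h `^ (- beta))); last first.
    by rewrite powRD_gt0// powR_mulrn ?(ltW h0)//; ring.
  apply: (ler_wpM2l (mulr_ge0 K0 (sqr_ge0 h))).
  move: Q1; rewrite mul1r sk => /(le_trans (ler_norm _)); apply: le_trans.
  by rewrite lerDr.
move: far_sum; under eq_bigr do rewrite big_split/=.
rewrite big_split/= => far_sum.
move: HP; rewrite sF sW -/F => HP.
have np := near_part_le.
rewrite /discreteR.
move: far_sum HP np; rewrite /ix.
set SF := \sum_(i < _) _; set SC := \sum_(i < _) _; set W := Winfty _ _ _ _ _ _.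
set Nr := ksigma sigma / 4 * _ * _ => H1 H2 H3.
(* The three errors: symmetrised near integral, interpolation on the far cells, discrete near term.
   The exterior terms cancel because [u p q] is [g x]. *)
have -> : - P - (Nr + SC - W * u p q) = - (P - (W * g x + SF)) - (SF + SC) - Nr.
  by rewrite /u -/x; ring.
rewrite (le_trans (ler_normB _ _))// mulrDl lerD//.
rewrite (le_trans (ler_normB _ _))// mulrDl lerD// normrN.
by apply: le_trans H2 _; rewrite le_eqVlt; apply/orP; left; apply/eqP; field.
Qed.

End Mesh.
End RealEstimate.

(** * Complex values and discrete norms *)

Section ComplexParts.
Variable R : realType.

Definition part (b : bool) (z : R[i]) : R := if b then complex.Re z else complex.Im z.

Lemma partD b (y z : R[i]) : part b (y + z) = part b y + part b z.
Proof. by case: b; case: y; case: z. Qed.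

Lemma partN b (z : R[i]) : part b (- z) = - part b z.
Proof. by case: b; case: z. Qed.

Lemma partB b (y z : R[i]) : part b (y - z) = part b y - part b z.
Proof. by rewrite partD partN. Qed.

Lemma part0 b : part b 0 = 0.
Proof. by case: b. Qed.

Lemma part_sum b (I : Type) (s : seq I) (P : pred I) (F : I -> R[i]) :
  part b (\sum_(i <- s | P i) F i) = \sum_(i <- s | P i) part b (F i).
Proof. exact: (big_morph _ (partD b) (part0 b)). Qed.

Lemma partZ b (c : R) (z : R[i]) : part b (z * c%:C) = part b z * c.
Proof. by case: b; case: z => u v /=; rewrite mulr0 ?subr0 ?add0r. Qed.

Lemma partZl b (c : R) (z : R[i]) : part b (c%:C * z) = c * part b z.
Proof. by rewrite mulrC partZ mulrC. Qed.

Lemma part_div b (c : R) (z : R[i]) : part b (z / c%:C) = part b z / c.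
Proof. by rewrite -fmorphV partZ. Qed.

Lemma part4 b (z : R[i]) : part b (4 * z) = 4 * part b z.
Proof. by rewrite -(rmorph_nat (real_complex R)) partZl. Qed.

Lemma part_cint2 b (D : set (R * R)) (f : R * R -> R[i]) :
  part b (cint2 D f) = int2 D (fun y => part b (f y)).
Proof. by case: b. Qed.

Lemma normc_le_parts (z : R[i]) :
  ComplexField.Normc.normc z <= `|part true z| + `|part false z|.
Proof.
case: z => u v; rewrite /part /ComplexField.Normc.normc/=.
rewrite -(@ler_pXn2r _ 2) ?nnegrE ?sqrtr_ge0 ?addr_ge0// sqr_sqrtr ?addr_ge0 ?sqr_ge0//.
rewrite sqrrD -!normrX !(ger0_norm (sqr_ge0 _)).
by have := mulr_ge0 (normr_ge0 u) (normr_ge0 v); lra.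
Qed.

Lemma part_bil b (s t : R) (w1 w2 w3 w4 : R[i]) :
  part b (((1 - s) * (1 - t))%:C * w1 + (s * (1 - t))%:C * w2 +
    ((1 - s) * t)%:C * w3 + (s * t)%:C * w4) =
  bil4 R s t (part b w1) (part b w2) (part b w3) (part b w4).
Proof. by rewrite !partD !partZl. Qed.

Lemma part_combination b (k c : R) (w1 w2 w3 s v : R[i]) :
  part b (k%:C * (w1 + w2 + w3) + s - c%:C * v) =
  k * (part b w1 + part b w2 + part b w3) + part b s - c * part b v.
Proof. by rewrite partB partD !partZl !partD. Qed.

End ComplexParts.

Lemma node_bounds (N : nat) (a : 'I_(nint N)) : (0 < N)%N ->
  - N%:Z < node a < N%:Z.
Proof. by rewrite /node => N0; have := ltn_ord a; rewrite /nint; lia. Qed.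

Lemma node_surj (N : nat) (i : int) : (0 < N)%N -> - N%:Z < i < N%:Z ->
  exists a : 'I_(nint N), node a = i.
Proof.
move=> N0 hi; have ha : (`|(i + N%:Z - 1)%R|%N < nint N)%N by rewrite /nint; lia.
by exists (Ordinal ha); rewrite /node/=; lia.
Qed.

Section Assembly.
Variables (R : realType) (beta gamma sigma l : R) (G : R * R -> R[i]).
Hypotheses (l0 : 0 < l) (G0 : forall z, ~ square l z -> G z = 0).

Lemma part_discrete_at b (N : nat) (u : int -> int -> R[i]) (p q : int) :
  part R b (discrete_at l N beta gamma sigma u p q) =
  c2 beta gamma *
    discreteR R beta gamma sigma l N p q (fun i j => part R b (u i j)).
Proof.
have phiE c d : part R b (phi l N gamma sigma u p q c d) =
    phiR R gamma sigma l N p q (fun i j => part R b (u i j)) c d.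
  by rewrite /phi part_div partB !partD part4.
have cellE i j : part R b (cell_int l N beta gamma u p q i j) =
    cellR R beta gamma l N p q (fun i j => part R b (u i j)) i j.
  rewrite /cell_int part_cint2 /cellR; congr int2; apply/funext => z.
  by rewrite partZ /bilin_interp part_bil !partZ !partB.
rewrite /discrete_at partZl; congr (_ * _).
rewrite /discreteR.
move: (phi l N gamma sigma u p q) (cell_int l N beta gamma u p q) phiE cellE => ph ci.
move: (phiR _ _ _ _ _ _ _ _) (cellR _ _ _ _ _ _ _ _) => phR ciR phE ciE.
rewrite part_combination !phE part_sum; congr (_ + _ - _).
by apply: eq_bigr => i _; rewrite part_sum; apply: eq_bigr => j _.
Qed.

(** [lim] identifies the principal value only once convergence is known, so the limit is taken as a
    hypothesis. *)
Lemma part_tempered_laplacian b (x : R * R) (P : R) :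
  int2 [set y | e < eucl_dist x y]
    (fun y => (part R b (G x) - part R b (G y)) * weight R beta gamma x y)
    @[e --> (0 : R)^'+] --> P ->
  part R b (tempered_laplacian beta gamma G x) = - (c2 beta gamma * P).
Proof.
move=> cP; rewrite /tempered_laplacian partN partZl; congr (- (_ * _)).
set f := fun y => _.
have E e : part R b (cint2 [set y | e < eucl_dist x y] f) =
    int2 [set y | e < eucl_dist x y]
      (fun y => (part R b (G x) - part R b (G y)) * weight R beta gamma x y).
  rewrite part_cint2; congr int2; apply/funext => y.
  by rewrite /f part_div partB weightE.
have -> : part R b (pv_int2 x f) =
    lim (part R b (cint2 [set y | e < eucl_dist x y] f) @[e --> (0 : R)^'+]).
  by rewrite /pv_int2; case: (b).
by under eq_fun do rewrite E; apply/cvg_lim.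
Qed.

Lemma point_outside (N : nat) (i j : int) : (0 < N)%N ->
  ~~ ((- N%:Z < i < N%:Z) && (- N%:Z < j < N%:Z)) ->
  ~ square l (Defs.point l N i j).
Proof.
move=> N0 /negP nij; rewrite /square/= => sq; apply: nij.
have h0 := mesh_gt0 R l N l0 N0; have e := esym (meshN R l N N0).
move: sq h0 e; move: (mesh l N) => h + h0 e.
by rewrite e -mulNr pmulrn -mulrNz !ltr_pM2r// !ltr_int.
Qed.

(** Non-interior indices correspond to points outside the open square, where [G] is 0, so extending
    by 0 agrees with sampling on the whole lattice. *)
Lemma ext0_sample (N : nat) : (0 < N)%N ->
  ext0 (sample l N G) = fun i j => G (Defs.point l N i j).
Proof.
move=> N0; apply/funext => i; apply/funext => j; rewrite /ext0.
case: pickP => [a /eqP ai|na]; last first.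
  rewrite G0//; apply: point_outside => //; apply/negP => /andP[/(node_surj N i N0)[a ai] _].
  by have := na a; rewrite ai eqxx.
case: pickP => [b /eqP bj|nb]; last first.
  rewrite G0//; apply: point_outside => //; apply/negP => /andP[_ /(node_surj N j N0)[b bj]].
  by have := nb b; rewrite bj eqxx.
by rewrite /sample mxvecK mxE ai bj.
Qed.

End Assembly.

(** There are fewer than [(2 N) ^ 2] nodes, each carrying [h ^ 2]. The total is at most the area
    [(2 l) ^ 2] of the square, whence the factor [2 * l]. *)
Lemma grid_norms_le (R : realType) (l B : R) (N : nat) (v : gridvec R N) :
  0 < l -> (0 < N)%N -> 0 <= B ->
  (forall k, ComplexField.Normc.normc (v 0 k) <= B) ->
  linfnorm v <= B /\ l2norm l v <= 2 * l * B.
Proof.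
move=> l0 N0 B0 vB; split; first by apply: bigmax_le.
have h0 := mesh_gt0 R l N l0 N0; have e := meshN R l N N0.
have lB0 : 0 <= 2 * l * B by rewrite !mulr_ge0// ltW.
rewrite /l2norm -[leRHS](ger0_norm lB0) -sqrtr_sqr ler_sqrt ?sqr_ge0//.
apply: (@le_trans _ _ (mesh l N ^+ 2 * ((N.*2 * N.*2)%:R * B ^+ 2))); last first.
  rewrite natrM -[in leRHS]e -mul2n natrM le_eqVlt; apply/orP; left; apply/eqP; ring.
rewrite ler_wpM2l ?sqr_ge0//.
apply: (@le_trans _ _ (\sum_(k < nint N * nint N) B ^+ 2)).
  apply: ler_sum => k _; rewrite lerXn2r ?nnegrE ?vB//.
  by case: (v 0 k) => x y; exact: sqrtr_ge0.
rewrite sumr_const card_ord -[leLHS]mulr_natl ler_wpM2r ?sqr_ge0// ler_nat.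
by apply: leq_mul; exact: leq_pred.
Qed.

Theorem theorem3p1 (R : realType) (beta gamma sigma l : R)
    (G : R * R -> R[i]) :
  0 < beta < 2 -> 0 <= gamma -> beta < sigma <= 2 -> 0 < l ->
  C2_closure (square l) G ->
  (forall z, ~ square l z -> G z = 0) ->
  exists C : R, 0 < C /\
    forall N : nat, (0 < N)%N ->
      let h := mesh l N in
      let err := sample l N (tempered_laplacian beta gamma G)
                 - discrete_laplacian l beta gamma sigma (sample l N G) in
      linfnorm err <= C * h `^ (2 - beta) /\
      l2norm l err <= C * h `^ (2 - beta).
Proof.
move=> /andP[beta0 beta2] gamma0 /andP[bs sigma2] l0 C2G G0.
(* The three exponents are [-2 - beta < -2], and [-beta] and [sigma - 2 - beta], which both lie in
   (-2, 0) since [0 < beta < sigma <= 2]. *)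
have [Cf Cf0 far'] := far_integral_le R (- (2 + beta)) ltac:(lra).
have [Cn Cn0 near'] := near_integral_le R (- beta) ltac:(lra).
have [Cw Cw0 nearW'] := near_integral_le R (sigma - 2 - beta) ltac:(lra).
have far (x : plane R) (r : R) : 0 < r ->
    (\int[mu2 R]_(y in ~` box R x r) (eucl_dist x y `^ (- (2 + beta)))%:E
     <= (Cf * r `^ (- beta))%:E)%E.
  by move=> r0; have := far' x r r0; rewrite (_ : 2 + - (2 + beta) = - beta)//; ring.
have nearW (x : plane R) (r : R) : 0 < r ->
    (\int[mu2 R]_(y in box R x r) (eucl_dist x y `^ (sigma - 2 - beta))%:E
     <= (Cw * r `^ (sigma - beta))%:E)%E.
  by move=> r0; have := nearW' x r r0; rewrite (_ : 2 + _ = sigma - beta)//; ring.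
have tameG b : exists M, tame R l M (fun z => part R b (G z)).
  have C2b : C2_closure_real (square l) (fun z => part R b (G z)).
    by case: C2G => Hre Him; case: b; [exact: Hre|exact: Him].
  have g0 z : ~ square l z -> part R b (G z) = 0 by move=> /G0 ->; exact: part0.
  exact: (C2_tame R l l0 _ C2b g0).
(* The constant is fixed before [N], [p] and [q], which is the uniformity claimed. *)
have partial b : exists2 C, 0 <= C & forall N (p q : int), (0 < N)%N ->
    - N%:Z < p < N%:Z -> - N%:Z < q < N%:Z ->
    `|part R b (tempered_laplacian beta gamma G (Defs.point l N p q)
       - discrete_at l N beta gamma sigma (fun i j => G (Defs.point l N i j)) p q)|
      <= C * mesh l N `^ (2 - beta).
  have [M tM] := tameG b; have M0 := tame_ge0 _ _ _ _ tM.
  pose K := 4 * M * gamma + 2 * M * (16 * gamma ^+ 2 * l + 3 * gamma) + 2 * M.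
  have K0 : 0 <= K by rewrite /K !addr_ge0 ?mulr_ge0 ?addr_ge0 ?mulr_ge0 ?sqr_ge0// ltW.
  exists (`|c2 beta gamma| * (4 * M * Cn + K * Cf + 32 * M * Cw)).
    by rewrite mulr_ge0// !addr_ge0// !mulr_ge0// ltW.
  move=> N p q N0 hp hq.
  have [P cP HP] := real_error R beta gamma sigma l M _ beta0 beta2 gamma0 bs sigma2 l0 tM
    N p q N0 hp hq Cf Cn Cw far near' nearW.
  rewrite partB part_discrete_at (part_tempered_laplacian R beta gamma G b _ P cP).
  rewrite -mulrN -mulrBr normrM -[leRHS]mulrA.
  exact: (ler_wpM2l (normr_ge0 _) HP).
have [[C1 C10 H1] [C2 C20 H2]] := (partial true, partial false).
(* The first summand serves the maximum norm and the second the l2 norm; the 1 makes the constant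
   positive even if [C1] and [C2] are 0. *)
exists ((C1 + C2) + 2 * l * (C1 + C2) + 1); split.
  by rewrite ltr_wpDl// addr_ge0 ?addr_ge0 ?mulr_ge0 ?addr_ge0// ltW.
move=> N N0 h err; have h0 : 0 < h by exact: mesh_gt0.
have hb : 0 <= h `^ (2 - beta) by exact: powR_ge0.
have errk k : ComplexField.Normc.normc (err 0 k) <= (C1 + C2) * h `^ (2 - beta).
  case/mxvec_indexP: k => a b.
  rewrite /err /discrete_laplacian /sample !mxE !mxvecE !mxE ext0_sample//.
  apply: le_trans (normc_le_parts _ _) _; rewrite mulrDl.
  by apply: lerD; [apply: H1|apply: H2] => //; exact: node_bounds.
have B0 : 0 <= (C1 + C2) * h `^ (2 - beta) by rewrite mulr_ge0// addr_ge0.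
have [n1 n2] := grid_norms_le R l _ N err l0 N0 B0 errk.
have lC : 0 <= 2 * l * (C1 + C2) by rewrite !mulr_ge0 ?addr_ge0// ltW.
split.
  apply: le_trans n1 _; rewrite ler_wpM2r//; lra.
apply: le_trans n2 _; rewrite mulrA ler_wpM2r//.
have C12 : 0 <= C1 + C2 by rewrite addr_ge0.
lra.
Qed.
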